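(* If $G$ is a (finite) Frobenius group of odd order with cyclic complement, then $G$ is generalized strongly monomial, all simple components of $\mathbb{Q}G$ have Schur index $1$, and none of them is exceptional.
   Context: All groups are finite and all characters are complex. For an irreducible character $\chi$ of a finite group $X$, $e_{\mathbb{Q}}(\chi)=\frac{\chi(1)}{|X|}\sum_{\sigma\in\operatorname{Gal}(\mathbb{Q}(\chi)/\mathbb{Q})}\sum_{g\in X}\sigma(\chi(g))g^{-1}$, a primitive central idempotent of $\mathbb{Q}X$. A pair $(H,K)$ of subgroups of $G$ is a Shoda pair if (i) $K\unlhd H$ and $H/K$ is cyclic; (ii) if $g\in G$ and $[H,g]\cap H\subseteq K$ then $g\in H$, where $[H,g]=\langle g^{-1}h^{-1}gh\mid h\in H\rangle$. Then $\lambda^G$ is irreducible for every linear character $\lambda$ of $H$ with kernel $K$. $(H,K)$ is a generalized strong Shoda pair if, for such $\lambda$, there is a chain of subgroups $H=H_0\le H_1\le\cdots\le H_n=G$ such that for all $0\le i\le n-1$: $H_i\unlhd\operatorname{Cen}_{H_{i+1}}(e_{\mathbb{Q}}(\lambda^{H_i}))$, and the distinct $H_{i+1}$-conjugates of $e_{\mathbb{Q}}(\lambda^{H_i})$ are mutually orthogonal. An irreducible character of $G$ is generalized strongly monomial if it equals $\lambda^G$ for some generalized strong Shoda pair $(H,K)$ of $G$ and linear character $\lambda$ of $H$ with kernel $K$; $G$ is generalized strongly monomial if all its irreducible characters are. The Schur index of a central simple algebra $\cong M_m(D)$ ($D$ a division algebra) is the square root of the dimension of $D$ over its center. A simple finite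 dimensional rational algebra is exceptional if it is one of: (i) a non-commutative division algebra different from a totally definite quaternion algebra; (ii) $M_2(\mathbb{Q})$; (iii) $M_2(F)$ with $F$ a quadratic imaginary extension of $\mathbb{Q}$; (iv) $M_2\left(\left(\frac{a,b}{\mathbb{Q}}\right)\right)$ with $a,b$ negative integers. *)

(* Defs.v *)
From HB Require Import structures.
From mathcomp Require Import all_boot all_order all_algebra.
From mathcomp Require Import all_fingroup all_solvable all_field all_character.
From mathcomp Require Import ring.

Set Implicit Arguments.
Unset Strict Implicit.
Unset Printing Implicit Defensive.

Import Order.TTheory GRing.Theory Num.Theory GroupScope.
Local Open Scope ring_scope.

(* The group algebra F[gT], an element being the function of its coefficients
   and the product being convolution. For G : {group gT}, the algebra F[G] is
   the subspace grpalg_of F G below, so that the algebras of all the subgroups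
   of gT live in the same type. *)
Definition grpalg (F : fieldType) (gT : finGroupType) := {ffun gT -> F}.

Section GroupAlgebra.
Variables (F : fieldType) (gT : finGroupType).
Local Notation A := (grpalg F gT).
Implicit Types (u v w : A) (g x y : gT).

HB.instance Definition _ := GRing.Lmodule.copy A {ffun gT -> F^o}.
HB.instance Definition _ := Vector.copy A {ffun gT -> F^o}.

Definition ga (g : gT) : A := [ffun x => (x == g)%:R].

Definition ga_mul u v : A := [ffun x => \sum_y u y * v (y^-1 * x)%g].

Fact ga_mulA : associative ga_mul.
Proof.
move=> u v w; apply/ffunP=> x; rewrite !ffunE.
under eq_bigr => y _ do rewrite ffunE mulr_sumr.
under [RHS]eq_bigr => z _ do rewrite ffunE mulr_suml.
rewrite [RHS]exchange_big /=; apply: eq_bigr => y _.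
rewrite [RHS](reindex_inj (mulgI y)) /=; apply: eq_bigr => z _.
by rewrite mulKg invMg -!mulgA mulrA.
Qed.

Fact ga_mul1l : left_id (ga 1%g) ga_mul.
Proof.
move=> u; apply/ffunP=> x; rewrite ffunE (bigD1 1%g) //= big1 ?addr0.
  by rewrite ffunE eqxx mul1r invg1 mul1g.
by move=> y /negPf ny; rewrite ffunE ny mul0r.
Qed.

Fact ga_mul1r : right_id (ga 1%g) ga_mul.
Proof.
move=> u; apply/ffunP=> x; rewrite ffunE (bigD1 x) //= big1 ?addr0.
  by rewrite ffunE mulVg eqxx mulr1.
move=> y /negPf ny; rewrite ffunE (_ : (_ == _) = false) ?mulr0 //.
by apply/negP=> /eqP yx1; rewrite -[x](mulKVg y) yx1 mulg1 eqxx in ny.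
Qed.

Fact ga_mulDl : left_distributive ga_mul +%R.
Proof.
move=> u v w; apply/ffunP=> x; rewrite !ffunE -big_split /=.
by apply: eq_bigr => y _; rewrite ffunE mulrDl.
Qed.

Fact ga_mulDr : right_distributive ga_mul +%R.
Proof.
move=> u v w; apply/ffunP=> x; rewrite !ffunE -big_split /=.
by apply: eq_bigr => y _; rewrite ffunE mulrDr.
Qed.

Fact ga_one_neq0 : ga 1%g != 0.
Proof.
by apply/eqP=> /ffunP/(_ 1%g)/eqP; rewrite !ffunE eqxx oner_eq0.
Qed.

HB.instance Definition _ := GRing.Zmodule_isNzRing.Build A
  ga_mulA ga_mul1l ga_mul1r ga_mulDl ga_mulDr ga_one_neq0.

Fact ga_scaleAl (k : F) u v : k *: (u * v) = (k *: u) * v.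
Proof.
apply/ffunP=> x; rewrite !ffunE scaler_sumr.
by apply: eq_bigr => y _; rewrite ffunE; apply: mulrA.
Qed.

HB.instance Definition _ := GRing.Lmodule_isLalgebra.Build F A ga_scaleAl.

Fact ga_scaleAr (k : F) u v : k *: (u * v) = u * (k *: v).
Proof.
apply/ffunP=> x; rewrite !ffunE scaler_sumr.
by apply: eq_bigr => y _; rewrite ffunE; apply: mulrCA.
Qed.

HB.instance Definition _ := GRing.Lalgebra_isAlgebra.Build F A ga_scaleAr.
HB.instance Definition _ := Algebra_isFalgebra.Build F A.

Lemma gaM g x : ga g * ga x = ga (g * x)%g.
Proof.
apply/ffunP=> y; rewrite ffunE (bigD1 g) //= big1 ?addr0.
  by rewrite !ffunE eqxx mul1r eq_sym -(inj_eq (mulgI g)) mulKVg eq_sym.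
by move=> z /negPf nz; rewrite ffunE nz mul0r.
Qed.

Definition ga_conj (u : A) (g : gT) : A := ga g^-1 * u * ga g.

Definition ga_cent (X : {set gT}) (u : A) : {set gT} :=
  [set g in X | ga_conj u g == u].

Definition grpalg_of (X : {set gT}) : {vspace A} := (\sum_(g in X) <[ga g]>)%VS.

End GroupAlgebra.

Arguments grpalg_of F {gT} X%_g.

Lemma abelian_num_normal (L : splittingFieldType rat) (n : nat) (w : L)
    (E : {subfield L}) :
    n.-primitive_root w -> <<1; w>>%VS = fullv -> galois 1 {:L} ->
  galois 1 E.
Proof.
move=> pr_w defL galL.
have galEL: galois E {:L} by apply: galoisS galL; rewrite sub1v subvf.
have AEnd_w (x : 'AEnd(L)) : exists k, x w = w ^+ k.
  have [|k ->] := prim_rootP pr_w (_ : x w ^+ n = 1); last by exists k.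
  by rewrite -rmorphXn /= prim_expr_order ?rmorph1.
have commxy (x y : 'AEnd(L)) a : x (y a) = y (x a).
  have /Fadjoin_polyP[p Kp ->]: a \in <<1; w>>%VS by rewrite defL memvf.
  have fixp (z : 'AEnd(L)) : map_poly z p = p.
    apply/polyP=> i; rewrite coef_map /=.
    by have /vlineP[c ->] := polyOverP Kp i; rewrite linearZ /= rmorph1.
  have hp (z : 'AEnd(L)) b : z p.[b] = p.[z b] by rewrite -{2}(fixp z) horner_map.
  rewrite !hp; congr _.[_].
  have [[j xw] [k yw]] := (AEnd_w x, AEnd_w y).
  by rewrite yw xw !rmorphXn /= xw yw -!exprM mulnC.
apply/and3P; split; first exact: sub1v.
  by apply: separableS (subvf E) _; case/and3P: galL.
apply/forall_inP=> x _.
rewrite -dimv_leqif_eq ?limg_dim_eq ?(eqP (AEnd_lker0 x)) ?capv0 //.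
apply/subvP=> _ /memv_imgP[a Ea ->].
rewrite -(galois_fixedField galEL); apply/fixedFieldP=> [|y galy].
  exact: memvf.
by rewrite commxy (fixed_gal (subvf _) galy Ea).
Qed.

(* The values of an irreducible character chi, realised in an abstract number
   field by vf_embed \o vf_val = chi; the subfield generated by the values
   vf_val is a copy of Q(chi), Galois over Q. *)
Record value_field (gT : finGroupType) (X : {group gT}) (i : Iirr X) :=
  ValueField {
    vf_sort : splittingFieldType rat;
    vf_embed : {rmorphism vf_sort -> algC};
    vf_val : gT -> vf_sort;
    vf_valE : forall x, vf_embed (vf_val x) = 'chi_i x;
    vf_galois : galois 1 <<1 & codom vf_val>>
  }.

Lemma irr_value_field (gT : finGroupType) (X : {group gT}) (i : Iirr X) :
  value_field i.
Proof.
have [L galL [iota _ [w [pr_w defL] La]]] := group_num_field_exists X.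
have La' x : {a : L | iota a = 'chi_i x}.
  have [Xx | notXx] := boolP (x \in X).
    exact: (La _ X _ (irr_char i) x (order_dvdG Xx)).
  by exists 0; rewrite rmorph0 cfun0.
exists L iota (fun x => sval (La' x)) => [x|]; first by case: (La' x).
exact: abelian_num_normal pr_w defL galL.
Qed.

Section RationalIdempotent.
Variables (gT : finGroupType) (X : {group gT}) (i : Iirr X).
Let V := irr_value_field i.

Definition char_field : {subfield vf_sort V} := <<1 & codom (vf_val V)>>%AS.

(* The coefficient chi(1) / |X| * \sum_sigma sigma (chi g) of g^-1 in
   e_Q(chi), where sigma ranges over Gal(Q(chi) / Q). *)
Definition eQ_coef (g : gT) : algC :=
  'chi_i 1%g / #|X|%:R
    * \sum_(sigma in 'Gal(char_field / 1)) vf_embed V (sigma (vf_val V g)).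

(* getCrat : algC -> rat inverts ratr on rational numbers; the lemma eQ_coefK
   shows that it is only applied to rational numbers. *)
Definition eQ : grpalg rat gT :=
  \sum_(g in X) getCrat (eQ_coef g) *: ga rat g^-1.

Lemma eQ_coefK g : ratr (getCrat (eQ_coef g)) = eQ_coef g.
Proof.
apply: getCratK; rewrite /eQ_coef -rmorph_sum -[\sum_(_ in _) _]/(galTrace _ _ _).
apply: rpredM; last first.
  have Ea: vf_val V g \in char_field by rewrite seqv_sub_adjoin ?codom_f.
  have /vlineP[c ->] := mem_galTrace (vf_galois V) Ea.
  by rewrite rmorphZ_num rmorph1 mulr1 Crat_rat.
by rewrite rpred_div ?rpred_nat // rpred_nat_num ?Cnat_irr1.
Qed.

End RationalIdempotent.

Section GenStronglyMonomial.
Variable gT : finGroupType.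
Implicit Types G H K : {group gT}.

(* [~: [set g], H] is generated by the g^-1 * h^-1 * g * h with h \in H. *)
Definition Shoda_pair G H K : Prop :=
  [/\ H \subset G, K <| H, cyclic (H / K)
    & {in G, forall g, [~: [set g], H] :&: H \subset K -> g \in H}].

(* One link H_i <= H_(i+1) of the chain, with e = e_Q(lambda^(H_i)). *)
Definition gss_link (Hi Hj : {group gT}) (e : grpalg rat gT) : Prop :=
  [/\ Hi \subset Hj, Hi <| ga_cent Hj e
    & {in Hj &, forall x y,
         ga_conj e x != ga_conj e y -> ga_conj e x * ga_conj e y = 0}].

(* When (H, K) is a Shoda pair and 'chi_l is linear with kernel K, the
   characters induced from 'chi_l to the subgroups between H and G are
   irreducible, and Ind_Iirr gives their indices. *)
Definition gen_strong_Shoda_pair G H K : Prop :=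
  Shoda_pair G H K /\
  forall l : Iirr H, 'chi_l \is a linear_char -> cfker 'chi_l = K ->
  exists (n : nat) (Hs : nat -> {group gT}),
    [/\ Hs 0%N = H, Hs n = G
      & forall i, (i < n)%N ->
          gss_link (Hs i) (Hs i.+1) (eQ (Ind_Iirr (Hs i) l))].

Definition gen_strongly_monomial_char G (chi : 'CF(G)) : Prop :=
  exists (H K : {group gT}) (l : Iirr H),
    [/\ gen_strong_Shoda_pair G H K, 'chi_l \is a linear_char,
        cfker 'chi_l = K & chi = 'Ind[G] 'chi_l].

Definition gen_strongly_monomial G : Prop :=
  forall i : Iirr G, gen_strongly_monomial_char 'chi_i.

End GenStronglyMonomial.

(* The quaternion algebra (a, b / R), (x0, x1, x2, x3) standing for
   x0 + x1 i + x2 j + x3 k, where i^2 = a, j^2 = b and i j = - j i = k. *)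
Definition quaternion (R : comNzRingType) (a b : R) := (R * R * R * R)%type.

Section Quaternion.
Variables (R : comNzRingType) (a b : R).
Local Notation Q := (quaternion a b).

HB.instance Definition _ := GRing.Zmodule.copy Q (R * R * R * R)%type.

Definition quat_one : Q := (1, 0, 0, 0).

Definition quat_mul (x y : Q) : Q :=
  let: (x0, x1, x2, x3) := x in let: (y0, y1, y2, y3) := y in
  (x0 * y0 + a * x1 * y1 + b * x2 * y2 - a * b * x3 * y3,
   x0 * y1 + x1 * y0 - b * x2 * y3 + b * x3 * y2,
   x0 * y2 + x2 * y0 + a * x1 * y3 - a * x3 * y1,
   x0 * y3 + x3 * y0 + x1 * y2 - x2 * y1).

Fact quat_mulA : associative quat_mul.
Proof.
by move=> [[[? ?] ?] ?] [[[? ?] ?] ?] [[[? ?] ?] ?] /=; do ![congr (_, _)]; ring.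
Qed.

Fact quat_mul1l : left_id quat_one quat_mul.
Proof. by move=> [[[? ?] ?] ?] /=; do ![congr (_, _)]; ring. Qed.

Fact quat_mul1r : right_id quat_one quat_mul.
Proof. by move=> [[[? ?] ?] ?] /=; do ![congr (_, _)]; ring. Qed.

Fact quat_addE (x0 x1 x2 x3 y0 y1 y2 y3 : R) :
  (x0, x1, x2, x3) + (y0, y1, y2, y3)
    = (x0 + y0, x1 + y1, x2 + y2, x3 + y3) :> Q.
Proof. by []. Qed.

Fact quat_mulDl : left_distributive quat_mul +%R.
Proof.
move=> [[[? ?] ?] ?] [[[? ?] ?] ?] [[[? ?] ?] ?].
by rewrite /quat_mul !quat_addE; do ![congr (_, _)]; ring.
Qed.

Fact quat_mulDr : right_distributive quat_mul +%R.
Proof.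
move=> [[[? ?] ?] ?] [[[? ?] ?] ?] [[[? ?] ?] ?].
by rewrite /quat_mul !quat_addE; do ![congr (_, _)]; ring.
Qed.

Fact quat_one_neq0 : quat_one != 0.
Proof. by apply/eqP=> -[/eqP]; rewrite oner_eq0. Qed.

HB.instance Definition _ := GRing.Zmodule_isNzRing.Build Q
  quat_mulA quat_mul1l quat_mul1r quat_mulDl quat_mulDr quat_one_neq0.

End Quaternion.

(* Between rational algebras every ring morphism is Q-linear. *)
Definition ring_iso (A B : nzRingType) : Prop :=
  exists f : {rmorphism A -> B}, bijective f.

Definition division_ring (A : unitRingType) : Prop :=
  forall x : A, x != 0 -> x \is a GRing.unit.

(* For A simple, D is unique up to isomorphism. *)
Definition has_Schur_index (A : falgType rat) (d : nat) : Prop :=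
  exists (m : nat) (D : falgType rat),
    [/\ division_ring D, ring_iso A 'M[D]_m.+1
      & \dim_('Z({:D})) {:D} = (d ^ 2)%N].

(* For a number field, the embeddings in algC are those in the complex
   numbers. *)
Definition totally_real (F : fieldExtType rat) : Prop :=
  forall (iota : {rmorphism F -> algC}) (x : F), iota x \is Num.real.

Definition totally_negative (F : fieldExtType rat) (a : F) : Prop :=
  forall iota : {rmorphism F -> algC}, iota a < 0.

Definition imaginary_quadratic (F : fieldExtType rat) : Prop :=
  \dim {:F} = 2%N /\
  forall iota : {rmorphism F -> algC}, exists x : F, iota x \isn't Num.real.

Definition totally_definite_quaternion (A : nzRingType) : Prop :=
  exists (F : fieldExtType rat) (a b : F),
    [/\ totally_real F, totally_negative a, totally_negative b
      & ring_iso A (quaternion a b)].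

Definition exceptional (A : falgType rat) : Prop :=
  [\/ [/\ division_ring A, ~ commutative (@GRing.mul A)
         & ~ totally_definite_quaternion A],
      ring_iso A 'M[rat]_2,
      exists2 F : fieldExtType rat, imaginary_quadratic F & ring_iso A 'M[F]_2
    | exists a b : int,
        [/\ a < 0, b < 0
          & ring_iso A 'M[quaternion (a%:~R : rat) (b%:~R : rat)]_2]].

Definition two_sided_ideal (A : falgType rat) (S I : {vspace A}) : Prop :=
  [/\ (I <= S)%VS, (S * I <= I)%VS & (I * S <= I)%VS].

(* The simple components of QG are its minimal nonzero two-sided ideals; as an
   {aspace _}, B is nonzero and has an identity element, usually not 1, which
   is the identity of the algebra subvs_of B. *)
Definition simple_component (gT : finGroupType) (G : {group gT})
    (B : {aspace grpalg rat gT}) : Prop :=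
  two_sided_ideal (grpalg_of rat G) B /\
  forall I : {vspace grpalg rat gT},
    two_sided_ideal (grpalg_of rat G) I -> (I <= B)%VS ->
    I = 0%VS \/ I = B.

(* Main.v *)
(* The kernel K of G is nilpotent. Indeed Thompson's criterion, which for groups
   of odd order rests on the bound |A| < |V : C_V(A)| of abelem_index_cent, gives
   O_p(K) != 1 for some p in a minimal counterexample; then Z(K) != 1, because in
   a Frobenius group acting coprimely on an abelian group, the complement fixing
   no point, the kernel acts trivially. As K is
   nilpotent of odd order, each psi in Irr(K) is induced from a linear character
   lambda of a subgroup L, chosen so that every field automorphism fixing psi
   fixes lambda. An irreducible character of G is either linear or of the form
   psi^G = lambda^G; L is subnormal in G, and every link of a subnormal series
   satisfies the conditions of a generalized strong Shoda pair, because the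
   conjugates of e_Q(theta), theta an irreducible character of a normal
   subgroup, are idempotents e_Q(theta') again.

   Let a simple component S be represented faithfully by chi = psi^G, and let e
   be a primitive idempotent of S. The rank of the image of e divides the trace
   of the image of every idempotent of S. Averaging over the complement H gives
   an idempotent of trace psi(1), a divisor of |K|, and e_Q(lambda) gives one of
   trace |{h in H : psi^h is Galois conjugate to psi}|, a divisor of |H|. Hence e
   has rank 1, so eSe acts by scalars and is commutative. Finally S is not a
   ring of 2 x 2 matrices, since the two diagonal units would have the same
   trace, while chi(1) is odd. *)

(* No component is realised over Q(chi): the complex representation ['Chi_j] is restricted to QG,
   and only traces of idempotents are used. Every idempotent f of a component is a sum of m products
   x_i y_i with y_i x_i = e, so its trace is m times the rank of e; coprime traces force rank 1, and
   the coprimality is that of |K| and |H|.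

   The trace of e_Q(lambda) counts the Galois conjugates of lambda that induce chi. For this to
   equal the number of such conjugates of psi, an automorphism fixing psi must fix lambda, so the
   monomiality of K is proved together with this control of fields. This explains the noncyclic
   elementary abelian normal subgroup E in that induction: its characters take values in the p-th
   roots of unity, on which automorphisms act with order dividing p - 1, while K acts on these
   characters as a p-group.

   Cyclicity of H makes the characters trivial on K linear and H solvable. Oddness of |G| enters in
   the index bound, in the existence of E and in the parity of chi(1). *)
From HB Require Import structures.
Require Import Defs.
From Stdlib Require Import Classical.
From mathcomp Require Import all_boot all_order all_algebra.
From mathcomp Require Import all_fingroup all_solvable all_field all_character.

Set Implicit Arguments.
Unset Strict Implicit.
Unset Printing Implicit Defensive.

Import Order.TTheory GRing.Theory Num.Theory GroupScope FiniteModule.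

(** * Normal p-complements *)

Section PNilpotent.

Variables (gT : finGroupType) (p : nat).
Implicit Types (G H K P Q S T X Y : {group gT}) (x g : gT).

Definition pnilpotent (G : {set gT}) := p.-nat #|G : 'O_p^'(G)|.

Lemma pnilpotent_normal G K :
  K <| G -> p^'.-group K -> p.-nat #|G : K| -> pnilpotent G.
Proof.
move=> nsKG p'K; apply: pnat_dvd; rewrite indexgS //.
by rewrite pcore_max.
Qed.

Lemma pnilpotentS G H : H \subset G -> pnilpotent G -> pnilpotent H.
Proof.
move=> sHG pnG; apply: (@pnilpotent_normal _ (H :&: 'O_p^'(G))).
- by rewrite /normal subsetIl normsI ?normG // (subset_trans sHG) ?gFnorm.
- by rewrite (pgroupS (subsetIr _ _)) ?pcore_pgroup.
rewrite indexgI; apply: pnat_dvd pnG.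
have nOH : H \subset 'N('O_p^'(G)) by rewrite (subset_trans sHG) ?gFnorm.
have -> : #|H : 'O_p^'(G)| = #|H / 'O_p^'(G)| by rewrite card_quotient.
by rewrite -card_quotient ?gFnorm // cardSg ?quotientS.
Qed.

Lemma pcore_sub_cent G X : X <| G -> p.-group X -> 'O_p^'(G) \subset 'C(X).
Proof.
move=> nsXG pX; have [sXG nXG] := andP nsXG.
rewrite centsC; apply/commG1P/trivgP.
have <- : X :&: 'O_p^'(G) = 1.
  by rewrite coprime_TIg ?(pnat_coprime pX) // -/(_.-group _) pcore_pgroup.
rewrite subsetI; apply/andP; split; rewrite ?commg_subl ?commg_subr.
  exact: subset_trans (gFsub _ _) nXG.
exact: subset_trans sXG (gFnorm _ _).
Qed.

Lemma pnilpotent_sylow_mul G S :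
  pnilpotent G -> p.-Sylow(G) S -> 'O_p^'(G) * S = G.
Proof.
move=> pnG sylS; have sSG := pHall_sub sylS.
have pS := pHall_pgroup sylS.
apply/eqP; rewrite eqEcard mul_subG ?gFsub //=.
rewrite coprime_cardMg; last first.
  by rewrite coprime_sym (pnat_coprime pS) // -/(_.-group _) pcore_pgroup.
rewrite (card_Hall sylS) -[X in X <= _](Lagrange (gFsub _ G : 'O_p^'(G) \subset G)).
rewrite leq_mul // -[X in X <= _](part_pnat_id pnG).
by rewrite dvdn_leq ?partn_dvd ?dvdn_indexg.
Qed.

Lemma pnilpotent_conj_sylow G X S T :
    pnilpotent G -> X <| G -> p.-group X -> p.-Sylow(G) S -> p.-Sylow(G) T ->
  exists2 c, c \in 'C_G(X) & T :=: S :^ c.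
Proof.
move=> pnG nsXG pX sylS sylT.
have [g Gg defT] := Sylow_trans sylS sylT.
have nOS : S \subset 'N('O_p^'(G)) by rewrite (subset_trans (pHall_sub sylS)) ?gFnorm.
have: g \in S * 'O_p^'(G) by rewrite (normC nOS) (pnilpotent_sylow_mul pnG sylS).
case/mulsgP=> s c Ss Oc def_g; exists c.
  apply/setIP; split; first by apply: subsetP Oc; apply: pcore_sub.
  exact: subsetP (pcore_sub_cent nsXG pX) c Oc.
by rewrite defT def_g conjsgM conjGid.
Qed.

End PNilpotent.

(** * Fusion when the normalisers of nontrivial p-subgroups are p-nilpotent *)

Section Fusion.

Variables (gT : finGroupType) (p : nat) (G : {group gT}).
Implicit Types (P Q R S T X : {group gT}).
Hypothesis pnN : forall X : {group gT},
  X \subset G -> p.-group X -> X :!=: 1 -> pnilpotent p 'N_G(X).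

(** Alperin's argument, by descending induction on [D]. Normalisers grow in p-groups, so [D] is
    proper in ['N_P(D)] and ['N_Q(D)]; Sylow subgroups [S], [T] of the p-nilpotent ['N_G(D)] above
    these are conjugate by some [c] centralising [D]. The moves from [P] to [R] and from [R :^ c] to
    [Q] have intersections larger than [D]. *)
Lemma sylow_conj_cent P Q :
    p.-Sylow(G) P -> p.-Sylow(G) Q ->
  exists2 c, c \in 'C_G(P :&: Q) & Q :=: P :^ c.
Proof.
have [n] := ubnP (#|G| - #|P :&: Q|); elim: n P Q => // n IHn P Q.
rewrite ltnS => leDn sylP sylQ; set D := (P :&: Q)%G.
have [sDP sDQ] : D \subset P /\ D \subset Q by rewrite subsetIl subsetIr.
have sDG : D \subset G := subset_trans sDP (pHall_sub sylP).
have pD : p.-group D := pgroupS sDP (pHall_pgroup sylP).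
have [D1 | ntD] := eqsVneq D 1.
  have [g Gg defQ] := Sylow_trans sylP sylQ.
  by exists g; rewrite // -/(gval D) D1 cent1T setIT.
have cardPQ : #|P| = #|Q| by rewrite (card_Hall sylP) (card_Hall sylQ).
have [sPQ | nsPQ] := boolP (P \subset Q).
  exists 1; first exact: group1.
  by rewrite conjsg1; apply/eqP; rewrite eq_sym eqEcard sPQ cardPQ /=.
have nsQP : ~~ (Q \subset P).
  apply: contra nsPQ => sQP; suffices /eqP <- : Q :==: P by [].
  by rewrite eqEcard sQP cardPQ /=.
have ltN R : p.-Sylow(G) R -> D \proper R -> D \proper 'N_R(D).
  by move=> sylR ltDR; apply: nilpotent_proper_norm ltDR; apply: pgroup_nil (pHall_pgroup sylR).
have ltNP : D \proper 'N_P(D) by rewrite ltN // /proper sDP subsetI subxx.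
have ltNQ : D \proper 'N_Q(D) by rewrite ltN // /proper sDQ subsetI subxx andbT.
have pnND := pnN sDG pD ntD.
have nsDN : D <| 'N_G(D) by rewrite normalSG.
have sNN R : p.-Sylow(G) R -> 'N_R(D) \subset 'N_G(D).
  by move=> sylR; rewrite setSI ?(pHall_sub sylR).
have pN R : p.-Sylow(G) R -> p.-group 'N_R(D).
  by move=> sylR; rewrite (pgroupS (subsetIl _ _)) ?(pHall_pgroup sylR).
have [S sylS sNS] := Sylow_superset (sNN P sylP) (pN P sylP).
have [T sylT sNT] := Sylow_superset (sNN Q sylQ) (pN Q sylQ).
have [c Cc defT] := pnilpotent_conj_sylow pnND nsDN pD sylS sylT.
have sSG : S \subset G by rewrite (subset_trans (pHall_sub sylS)) ?subsetIl.
have [R sylR sSR] := Sylow_superset sSG (pHall_pgroup sylS).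
have Gc : c \in G by case/setIP: Cc => /setIP[].
have lt_step (A B : {group gT}) : p.-Sylow(G) A -> p.-Sylow(G) B ->
    D \proper A :&: B -> exists2 a, a \in 'C_G(D) & B :=: A :^ a.
  move=> sylA sylB ltD; have [|a Ca ->] := IHn A B _ sylA sylB.
    apply: leq_trans leDn; rewrite ltn_sub2l ?(proper_card ltD) //.
    apply: leq_trans (proper_card ltD) _; rewrite subset_leq_card //.
    by rewrite subIset // (pHall_sub sylA).
  by exists a => //; apply: subsetP Ca; rewrite setIS // centS // proper_sub.
have [|a Ca defR] := lt_step P R sylP sylR.
  apply: proper_sub_trans ltNP _.
  by rewrite subsetI subsetIl (subset_trans sNS).
have sylRc : p.-Sylow(G) (R :^ c) by rewrite pHallJ.
have [|b Cb defQ] := lt_step (R :^ c)%G Q sylRc sylQ.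
  apply: proper_sub_trans ltNQ _.
  by rewrite subsetI subsetIl andbT (subset_trans sNT) // defT conjSg.
exists (a * c * b); last by rewrite defQ /= !conjsgM -defR.
have CDc : c \in 'C_G(D) by case/setIP: Cc => _ cDc; apply/setIP.
exact: (groupM (groupM Ca CDc) Cb).
Qed.

(** As [x] lies in [P] and [P :^ g^-1], the [c] of [sylow_conj_cent] fixes [x], and [c * g]
    normalises [P]. In ['N_G(P)], the product of its p'-core and [P], the p'-core centralises [P],
    so only a factor from [P] moves [x]. *)
Lemma sylow_fusion P x g :
    p.-Sylow(G) P -> x \in P -> g \in G -> x ^ g \in P ->
  exists2 c, c \in P & x ^ g = x ^ c.
Proof.
move=> sylP Px Gg Pxg; have [-> | ntx] := eqVneq x 1.
  by exists 1; rewrite ?conj1g.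
have sPG := pHall_sub sylP; have pP := pHall_pgroup sylP.
have ntP : P :!=: 1 by apply: contraNneq ntx => P1; rewrite P1 inE in Px.
have sylQ : p.-Sylow(G) (P :^ g^-1) by rewrite pHallJ ?groupV.
have [c Cc defQ] := sylow_conj_cent sylP sylQ.
have cxc : x ^ c = x.
  have Dx : x \in P :&: P :^ g^-1 by rewrite inE Px mem_conjgV.
  by case/setIP: Cc => _ /centP/(_ x Dx)/commute_sym/commgP/conjg_fixP.
have Gc : c \in G by case/setIP: Cc.
have Ncg : c * g \in 'N_G(P).
  by rewrite inE groupM // inE conjsgM -defQ /= -conjsgM mulVg conjsg1.
have nsPN : P <| 'N_G(P) by rewrite normalSG.
have sylPN : p.-Sylow('N_G(P)) P.
  by apply: pHall_subl sylP; [rewrite normal_sub | rewrite subsetIl].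
have: c * g \in 'O_p^'('N_G(P)) * P.
  by rewrite (pnilpotent_sylow_mul (pnN sPG pP ntP) sylPN).
case/mulsgP=> v u Ov Pu def_cg; exists u => //.
have /centP/(_ x Px)/commute_sym/commgP/conjg_fixP xv := subsetP (pcore_sub_cent nsPN pP) v Ov.
by rewrite -{1}cxc -conjgM def_cg conjgM xv.
Qed.

End Fusion.

(** Transfer to the abelianisation of [P]: since [P] controls its own fusion, the transfer raises
    elements of [P] to the power |G : P|, prime to p, so its kernel meets [P] in the derived
    subgroup. The kernel is therefore proper, of p-power index, and its normal p-complement is one
    of [G]. *)
Theorem frobenius_pnilpotent (gT : finGroupType) (p : nat) (G : {group gT}) :
  (forall X : {group gT},
     X \subset G -> p.-group X -> X :!=: 1 -> pnilpotent p 'N_G(X)) ->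
  pnilpotent p G.
Proof.
have [n] := ubnP #|G|; elim: n G => // n IHn G; rewrite ltnS => leGn pnN.
have [P sylP] := Sylow_exists p G.
have [sPG pP _] := and3P sylP.
have [P1 | ntP] := eqsVneq P 1.
  apply: (@pnilpotent_normal _ _ G G); rewrite ?normal_refl ?indexgg //.
  by rewrite /pgroup -partn_eq1 // -(card_Hall sylP) P1 cards1.
pose alpha := restrm (der_norm 1 P) (coset P^`(1)).
have abP : abelian (alpha @* P).
  by rewrite morphim_restrm setIid -quotientE (der_abelian 0 P).
pose V := [morphism of transfer G abP].
have pV : p.-nat #|V @* G|.
  apply: pnat_dvd (cardSg (subsetT _)) _.
  by rewrite cardsT card_sub; apply: morphim_pgroup.
have pGN : p.-nat #|G : 'ker V|.
  by rewrite -card_quotient ?ker_norm // (card_isog (first_isog V)).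
have sPN : P :&: 'ker V \subset P^`(1).
  apply/subsetP=> x /setIP[Px /morphpreP[Gx /set1P Vx1]].
  have trX := transversalP (rcosets_cycle_partition sPG Gx).
  set X := transversal _ _ in trX.
  pose fa := restrm (transfer_morph_subproof alpha) (fmod abP \o alpha).
  (* Each factor of the cycle expansion of the transfer is a conjugate in [P] of a power of [x]; by
     [sylow_fusion] it is even conjugate to that power under [P], so both agree modulo the derived
     subgroup. *)
  have Vx y : y \in X -> fa ((x ^+ #|<[x]> : P :* y|) ^ y^-1) = (fa x *+ #|<[x]> : P :* y|)%R.
    move=> Xy; have Gy := subsetP (transversal_sub trX) y Xy.
    have Px' : (x ^+ #|<[x]> : P :* y|) ^ y^-1 \in P.
      by rewrite conjgE invgK mulgA -mem_rcoset mulg_exp_card_rcosets.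
    have [||c Pc ->] := sylow_fusion pnN sylP _ _ Px'; rewrite ?groupX ?groupV //.
    have aP z : z \in P -> alpha z \in alpha @* P by move=> Pz; rewrite mem_morphim.
    have faE z : fa z = fmod abP (alpha z) by [].
    rewrite !faE -fmodX ?aP //; congr fmod; have := morphJ alpha (groupX _ Px) Pc.
    move/(_ #|<[x]> : P :* y|)=> alphaJ; apply: etrans alphaJ _; rewrite morphX //.
    by apply/conjg_fixP/commgP; apply: (centsP abP); rewrite ?groupX ?aP.
  have /eqP : (fa x *+ #|G : P| == 0)%R.
    rewrite -(sum_index_rcosets_cycle sPG Gx trX) -GRing.sumrMnr.
    rewrite -(eq_bigr _ Vx) -(transfer_cycle_expansion sPG abP Gx trX).
    exact/eqP.
  have faE z : fa z = fmod abP (alpha z) by [].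
  rewrite faE -fmodX ?mem_morphim // -morphX //.
  rewrite -(fmod1 abP) => fax1.
  have := congr_fmod fax1.
  rewrite !fmodK ?mem_morphim ?groupX ?group1 // => ax1.
  have cop : coprime #|P| #|G : P|.
    rewrite (pnat_coprime pP) //; case/and3P: sylP => _ _; apply: sub_in_pnat => q _.
    by [].
  rewrite -(expgK cop Px) groupX // coset_idr ?groupX //.
  by rewrite (subsetP (der_norm 1 P)).
have ltNG : 'ker V \proper G.
  rewrite properEneq (normal_sub (ker_normal V)) andbT; apply: contraTneq sPN => ->.
  rewrite (setIidPl sPG); apply: proper_subn.
  apply: (nil_comm_properl (pgroup_nil pP) (subxx P) ntP).
  by rewrite subsetI subxx normG.
have pnK : pnilpotent p ('ker V).
  apply: IHn; first exact: leq_trans (proper_card ltNG) leGn.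
  move=> X sXN pX ntX; apply: pnilpotentS (pnN X _ pX ntX).
    by rewrite setSI ?(normal_sub (ker_normal V)).
  by rewrite (subset_trans sXN) ?(normal_sub (ker_normal V)).
apply: (@pnilpotent_normal _ _ G 'O_p^'('ker V)); rewrite ?pcore_pgroup //.
  exact: gFnormal_trans (ker_normal V).
by rewrite -(Lagrange_index (normal_sub (ker_normal V)) (pcore_sub _ _)) pnatM pGN.
Qed.

(** * Traces of group actions on an abelian group, written additively *)

Section Traces.

Variables (gT : finGroupType) (N : {group gT}) (abN : abelian N).
Implicit Types (A H K E W : {group gT}).
Local Open Scope ring_scope.
Local Notation "u ^@ x" := (actr u x) : ring_scope.

Definition trace_fmod (A : {set gT}) (u : fmod_of abN) := \sum_(x in A) u ^@ x.

Lemma trace_fmod_cent (A : {group gT}) u : A \subset 'N(N)%g -> fmval (trace_fmod A u) \in 'C_N(A)%g.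
Proof.
move=> nNA; rewrite inE fmodP; apply/centP=> a Aa.
apply/commgP/conjg_fixP.
have tra : trace_fmod A u ^@ a = trace_fmod A u.
  rewrite /trace_fmod (big_morph _ (actAr a) (act0r abN a)).
  rewrite [RHS](reindex_inj (mulIg a)) /=; apply: eq_big => [x | x Ax].
    by rewrite groupMr.
  by rewrite -actrM ?(subsetP nNA).
by have := congr_fmod tra; rewrite fmvalJ ?(subsetP nNA).
Qed.

End Traces.

Section TraceApplications.

Local Open Scope ring_scope.
Local Notation "u ^@ x" := (actr u x) : ring_scope.

(* The trace of an element over KH, which centralises H, is its trace over K
   plus, for each conjugate of H, the trace over that conjugate minus the
   element itself: so a multiple of the element by a number prime to #|N|
   centralises K. *)
Lemma Frobenius_act_cent (gT : finGroupType) (E K H N : {group gT}) :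
    [Frobenius E = K ><| H] -> abelian N -> E \subset 'N(N) ->
  coprime #|N| #|K| -> 'C_N(H) = 1%g -> N \subset 'C(K).
Proof.
move=> frobE abN nNE copNK regH; have [/= defE _ _ _ _] := Frobenius_context frobE.
have [/= sKE sHE _ _ _] := sdprod_context defE.
have /and3P[/eqP covE tiE _] := Frobenius_partition frobE.
have [nNK nNH] : K \subset 'N(N) /\ H \subset 'N(N).
  by split; apply: subset_trans nNE; rewrite ?(normal_sub sKE).
have sKE' : K \subset E := normal_sub sKE.
apply/subsetP=> v Nv; set u := fmod abN v.
have trH x : x \in K -> \sum_(y in H^# :^ x) u ^@ y = - u.
  move=> Kx; have nNx : x \in 'N(N) by rewrite (subsetP nNK).
  have trHx0 : trace_fmod (H :^ x) u = 0.
    apply: fmod_inj; rewrite fmval0; apply/set1P; change (fmval (trace_fmod (H :^ x) u) \in (1%g : {set gT})).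
    rewrite -(conjs1g x) -regH conjIg (normP nNx) -centJ; apply: (trace_fmod_cent (A := (H :^ x)%G)).
    by rewrite /= -(normP nNx) normJ conjSg.
  move: trHx0; rewrite /trace_fmod (bigD1 1%g) ?group1 //= actr1 => /eqP.
  rewrite addrC addr_eq0 => /eqP <-; apply: eq_bigl => y.
  by rewrite conjD1g !inE andbC.
have trE : trace_fmod E u = 0.
  apply: fmod_inj; rewrite fmval0; apply/set1P; change (fmval (trace_fmod E u) \in (1%g : {set gT})); rewrite -regH.
  by rewrite (subsetP _ _ (trace_fmod_cent u nNE)) // setIS // centS.
move: trE; rewrite /trace_fmod -covE big_trivIset //= big_setU1 /=; last first.
  apply/imsetP=> -[x Kx defK]; have := group1 K.
  by rewrite defK conjD1g !inE eqxx.
rewrite [X in _ + X](eq_bigr (fun _ => - u)) => [|_ /imsetP[x Kx ->]]; last first.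
  exact: trH.
rewrite sumr_const mulNrn => /eqP; rewrite subr_eq0 => /eqP trK.
have copm : coprime #|N| #|H^# :^: K|.
  apply: coprime_dvdr copNK; rewrite -orbitJs.
  exact: dvdn_orbit.
rewrite -(expgK copm Nv) groupX // -(fmodK abN Nv).
rewrite -fmvalZ -/u -trK.
by have := trace_fmod_cent u nNK; rewrite inE => /andP[].
Qed.

(** The trace of [u] over each of the p + 1 subgroups of order p of [E] is fixed by that subgroup,
    so lies in [W]. These traces add up to p u plus the trace over [E], which lies in [W] too; and p
    is invertible on [N]. *)
Lemma abelem2_act_gen (gT : finGroupType) (p : nat) (E N W : {group gT}) :
    prime p -> p.-abelem E -> #|E| = (p ^ 2)%N -> abelian N -> E \subset 'N(N) ->
  coprime #|N| p -> {in E^#, forall x, 'C_N[x] \subset W} -> N \subset W.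
Proof.
move=> p_pr abE oE abN nNE copNp sCW.
(* The blocks are the subgroups of order p with the identity removed. *)
pose P := preim_partition (fun x : gT => <[x]>) E^#.
have partP : partition P E^# := preim_partitionP _ _.
have defP T : T \in P -> exists2 x, x \in E^# & T = <[x]>^#.
  case/imsetP=> x Ex ->; exists x => //; apply/setP=> y; rewrite inE /=.
  have [/setD1P[ntx Ex']] := (Ex, I) => _.
  apply/andP/setD1P=> [[/setD1P[nty Ey] /eqP cxy] | [nty xy]].
    by rewrite cxy cycle_id.
  have Ey : y \in E by apply: subsetP xy; rewrite cycle_subG.
  split; first by rewrite !inE nty.
  rewrite eq_sym eqEcard cycle_subG xy /=.
  by rewrite -!/(order _) !(abelem_order_p abE).
have cardT T : T \in P -> #|T| = p.-1.
  case/defP=> x /setD1P[ntx Ex] ->.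
  by rewrite cardsDS ?sub1G // cards1 -/(order x) (abelem_order_p abE) // subn1.
have p1_gt0 : (0 < p.-1)%N by rewrite -subn1 subn_gt0 prime_gt1.
have oP : #|P| = p.+1.
  apply/eqP; rewrite -(eqn_pmul2r p1_gt0) -(card_uniform_partition cardT partP).
  rewrite cardsDS ?sub1G // cards1 oE -[X in (_ - X)%N](exp1n 2).
  by rewrite subn_sqr addn1 subn1 mulnC.
have /and3P[/eqP covP tiP _] := partP.
apply/subsetP=> v Nv; set u := fmod abN v.
have WC x (A : {group gT}) : x \in E^# -> x \in A -> A \subset E ->
    fmval (trace_fmod A u) \in W.
  move=> Ex Ax sAE; apply: (subsetP (sCW x Ex)).
  apply: subsetP (trace_fmod_cent u (subset_trans sAE nNE)).
  by rewrite setIS // -cent_set1 centS // sub1set.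
have trT T : T \in P -> fmval (u + \sum_(y in T) u ^@ y) \in W.
  case/defP=> x Ex ->; have [_ Ex'] := setD1P Ex.
  have := WC x <[x]>%G Ex (cycle_id x); rewrite cycle_subG => /(_ Ex').
  by rewrite /trace_fmod (bigD1 1%g) ?group1 //= actr1 (eq_bigl (mem <[x]>^#)) // => y;
     rewrite !inE andbC.
have [x Ex] : exists x, x \in E^#.
  have /trivgPn[x Ex ntx] : E :!=: 1%g.
    by rewrite -cardG_gt1 oE -(exp1n 2) ltn_exp2r ?prime_gt1.
  by exists x; rewrite !inE ntx.
have WE := WC x E Ex (subsetP (subD1set E 1%g) x Ex) (subxx _).
have : fmval (\sum_(T in P) (u + \sum_(y in T) u ^@ y)) \in W.
  elim/big_ind: _ => [|a b Wa Wb|]; last exact: trT.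
    by rewrite fmval0 group1.
  by rewrite fmvalA groupM.
have -> : \sum_(T in P) (u + \sum_(y in T) u ^@ y) = u *+ p + trace_fmod E u.
  rewrite big_split /= sumr_const oP -big_trivIset //= covP mulrSr -addrA; congr (_ + _).
  rewrite /trace_fmod [in RHS](bigD1 1%g) ?group1 //= actr1; congr (_ + _).
  by apply: eq_bigl => y; rewrite !inE andbC.
rewrite fmvalA groupMr // fmvalZ fmodK // => Wvp.
by rewrite -(expgK copNp Nv) groupX.
Qed.

End TraceApplications.

(** * Coprime actions *)

Section CoprimeActions.

Variables (gT : finGroupType) (p : nat).
Implicit Types (A B E M N S V : {group gT}).

(** It suffices to treat the [A]-invariant Sylow subgroups [S] of [M]. By [abelem2_act_gen],
    [S / 'Phi(S)] lies in any subgroup containing the fixed points of the nontrivial elements of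
    [E]; these fixed points lift to [S], where [A] centralises them. So [S] is generated by
    ['Phi(S)] and ['C_S(A)], hence is ['C_S(A)]. *)
Lemma abelem2_coprime_cent A M :
    prime p -> p.-abelem A -> (p < #|A|)%N -> A \subset 'N(M) -> p^'.-group M ->
  {in A^#, forall x, 'C_M[x] \subset 'C(A)} -> M \subset 'C(A).
Proof.
move=> p_pr abA ltpA nMA p'M cMA.
have pA := abelem_pgroup abA; have cAA := abelem_abelian abA.
have cop (X : {group gT}) : X \subset M -> coprime #|X| #|A|.
  by move=> sXM; rewrite coprime_sym (pnat_coprime pA) //; apply: pgroupS sXM p'M.
have [E sEA oE] : exists2 E : {group gT}, E \subset A & #|E| = (p ^ 2)%N.
  have [|E [sEA _ oE]] := normal_pgroup (r := 2) pA (normal_refl A).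
    by rewrite -(ltn_exp2l 1 _ (prime_gt1 p_pr)) -(card_pgroup pA).
  by exists E.
have abE := abelemS sEA abA.
suffices sylC q (S : {group gT}) : q.-Sylow(M) S -> A \subset 'N(S) -> S \subset 'C(A).
  rewrite -(setIidPl (_ : M \subset M)) //; apply/setIidPl/eqP.
  rewrite setIid eqEcard subsetIl /= dvdn_leq // ?cardG_gt0 //.
  apply/dvdn_partP=> // q _.
  have [S sylS nSA] := sol_coprime_Sylow_exists q (pgroup_sol pA) nMA (cop M (subxx _)).
  rewrite -(card_Hall sylS) cardSg // subsetI (pHall_sub sylS).
  exact: sylC sylS nSA.
move=> sylS nSA; have sSM := pHall_sub sylS.
have qS := pHall_pgroup sylS.
have nPhiA : A \subset 'N('Phi(S)) by rewrite gFnorm_trans.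
have copS := cop S sSM.
have solS : solvable S := pgroup_sol qS.
have nPhiE := subset_trans sEA nPhiA.
have sSC : S / 'Phi(S) \subset 'C_S(A) / 'Phi(S).
  apply: (@abelem2_act_gen _ p (E / 'Phi(S)) (S / 'Phi(S)) ('C_S(A) / 'Phi(S))) => //.
  - exact: quotient_abelem.
  - rewrite -oE; apply/esym/card_isog/quotient_isog => //.
    by rewrite coprime_TIg // (coprimeSg (Phi_sub S)) // (coprimegS sEA).
  - exact: abelem_abelian (Phi_quotient_abelem qS).
  - by rewrite quotient_norms // (subset_trans sEA).
  - rewrite (coprime_dvdl (dvdn_quotient _ _)) //.
    by apply: coprime_dvdr copS; rewrite (dvdn_trans _ (cardSg sEA)) // oE dvdn_mulr.
  move=> xb /setD1P[ntx /morphimP[x Nx Ex defx]].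
  have ntx' : x \in A^#.
    rewrite !inE (subsetP sEA) // andbT; apply: contraNneq ntx => x1.
    by rewrite defx x1 morph1.
  rewrite defx -cent_cycle -quotient_cycle // -coprime_quotient_cent ?Phi_sub //.
  - rewrite quotientS // subsetI subsetIl cent_cycle.
    by apply: subset_trans (cMA x ntx'); rewrite setSI.
  - by rewrite cycle_subG.
  by apply: coprime_dvdr copS; rewrite order_dvdG // (subsetP sEA).
have {}defS : 'C_S(A) = S.
  suffices genS : 'Phi(S) <*> 'C_S(A) = S by have := Phi_nongen genS; rewrite genGid.
  apply/eqP; rewrite eqEsubset join_subG Phi_sub subsetIl /=.
  rewrite norm_joinEr; last by rewrite (subset_trans (subsetIl _ _)) ?gFnorm.
  by rewrite -quotientSK ?gFnorm.
by rewrite -defS subsetIr.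
Qed.

(** Thompson's A x B lemma for abelian [V]. If [V, N] were nontrivial, the p-group [B] would fix a
    nontrivial element of it; that element would be centralised by [N], but coprime action gives
    ['C_V(N)] and [V, N] trivial intersection. *)
Lemma AxB_cent B N V :
    p.-group V -> abelian V -> p.-group B -> p^'.-group N ->
    B \subset 'N(V) -> N \subset 'N(V) -> N \subset 'C(B) ->
  'C_V(B) \subset 'C(N) -> V \subset 'C(N).
Proof.
move=> pV abV pB p'N nVB nVN cBN cVBN.
have cop : coprime #|V| #|N| by rewrite (pnat_coprime pV).
have TI := coprime_abel_cent_TI nVN cop abV.
rewrite -[_ \subset _]/(gval V \subset 'C(N)); apply/commG1P/eqP/idPn => ntW.
have sWV : [~: V, N] \subset V by rewrite commg_subl.
have nWB : B \subset 'N([~: V, N]).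
  by rewrite normsR // cents_norm // centsC.
have pWB : p.-group ([~: V, N] <*> B).
  by rewrite norm_joinEr // pgroupM pB (pgroupS sWV).
have nsW : [~: V, N] <| [~: V, N] <*> B.
  by rewrite /normal joing_subl join_subG normG.
have := meet_center_nil (pgroup_nil pWB) nsW ntW.
case/negP; rewrite -subG1 -TI subsetI subsetIl.
apply: subset_trans cVBN; rewrite subsetI (subset_trans (subsetIl _ _) sWV).
by rewrite (subset_trans (subsetIr _ _)) // subIset // orbC centS ?joing_subr.
Qed.

End CoprimeActions.

(** * A lower bound for the index of the fixed points of an elementary abelian p-group *)

Section QuadraticIndex.

Variables (gT : finGroupType) (p : nat).
Implicit Types (A B M S T V : {group gT}).

Section PrimeOrder.

Variables V M A : {group gT}.
Hypotheses (abV : p.-abelem V) (p'M : p^'.-group M) (oA : #|A| = p).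
Hypotheses (p_pr : prime p) (oddM : odd #|M|) (odd_p : odd p).
Hypotheses (nVM : M \subset 'N(V)) (nVA : A \subset 'N(V)) (nMA : A \subset 'N(M)).
Hypotheses (cMV : 'C_M(V) = 1) (cAM : 'C_A(M) = 1).

Let pA : p.-group A. Proof. by rewrite /pgroup oA pnat_id. Qed.
Let tiMA : M :&: A = 1.
Proof. by rewrite setIC coprime_TIg ?(pnat_coprime pA). Qed.
Let oMA : #|M <*> A| = (#|M| * p)%N.
Proof. by rewrite norm_joinEr // TI_cardMg // oA. Qed.
Let nVMA : M <*> A \subset 'N(V). Proof. by rewrite join_subG nVM. Qed.

Let sylMA S : S \subset M <*> A -> #|S| = p -> p.-Sylow(M <*> A) S.
Proof.
move=> sSG oS; rewrite pHallE sSG oS oMA mulnC partnM // ?prime_gt0 //.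
by rewrite part_pnat_id ?pnat_id // part_p'nat // muln1 /=.
Qed.

Let cardSyl (Y : {group gT}) S : A \subset Y -> Y \subset M <*> A ->
  p.-Sylow(Y) S -> #|S| = p.
Proof.
move=> sAY sYG sylS; rewrite (card_Hall sylS).
by rewrite -(card_Hall (pHall_subl sAY sYG (sylMA (joing_subr _ _) oA))) oA.
Qed.

(* A p'-subgroup of MA lies in M, hence acts faithfully on V. *)
Let hyper_pgroup (Z C : {group gT}) : Z \subset M <*> A -> C \subset V ->
  [~: V, Z] \subset C -> Z \subset 'C(C) -> p.-group Z.
Proof.
move=> sZG sCV sVZC cZC; apply/pgroupP=> q q_pr /Cauchy[//|x Zx oxq].
rewrite inE; apply/idPn=> neqp; have p'x : p^'.-group <[x]>.
  by rewrite /pgroup -orderE oxq pnatE // !inE.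
have Mx : <[x]> \subset M.
  have sxG : <[x]> \subset M <*> A by rewrite cycle_subG (subsetP sZG).
  have nsM : M <| M <*> A by rewrite /normal joing_subl join_subG normG.
  have hallM : p^'.-Hall(M <*> A) M.
    apply/and3P; rewrite p'M joing_subl; split=> //.
    rewrite -divgS ?joing_subl // oMA mulKn // pnatNK pnat_id //.
  by rewrite (sub_normal_Hall hallM).
have cVx : <[x]> \subset 'C(V).
  have copVx : coprime #|V| #|<[x]>| by rewrite (pnat_coprime (abelem_pgroup abV)).
  have nVx : <[x]> \subset 'N(V) := subset_trans Mx nVM.
  have TI := coprime_abel_cent_TI nVx copVx (abelem_abelian abV).
  rewrite centsC; apply/commG1P/trivgP; rewrite -TI subsetI subxx centsC /=.
  have sxZ : <[x]> \subset Z by rewrite cycle_subG.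
  apply: subset_trans (subset_trans sxZ cZC) _; apply: centS.
  by apply: subset_trans sVZC; apply: commgS.
have : <[x]> \subset 'C_M(V) by rewrite subsetI Mx.
by rewrite cMV subG1 cycle_eq1 -order_eq1 oxq; apply/negP/eqP => q1; rewrite q1 in q_pr.
Qed.

Let conjA (S : {group gT}) : S \subset M <*> A -> #|S| = p ->
  exists2 y, y \in M <*> A & S :=: A :^ y.
Proof.
by move=> sSG oS; apply: Sylow_trans (sylMA (joing_subr _ _) oA) (sylMA sSG oS).
Qed.

Let ncAV : 'C_V(A) \proper V.
Proof.
rewrite properE subsetIl subsetI subxx /=; apply/negP=> cVA.
have: A \subset 'C(M).
  apply/commG1P/trivgP; rewrite /= commGC -cMV subsetI commg_subl nMA /=.
  apply: subset_trans (_ : [~: M, 'C(V)] \subset _); first by rewrite commgS // centsC.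
  by rewrite commg_subr (subset_trans nVM) // cent_norm.
move/setIidPl; rewrite cAM => A1.
by move: p_pr; rewrite -oA -A1 cards1.
Qed.

Let cardC (S : {group gT}) : #|V : 'C_V(A)| <= p -> S \subset M <*> A -> #|S| = p ->
  (p * #|'C_V(S)|)%N = #|V|.
Proof.
move=> leVp sSG /(conjA sSG)[y Gy ->].
have -> : 'C_V(A :^ y) = 'C_V(A) :^ y by rewrite conjIg centJ (normsP nVMA).
rewrite cardJg -(Lagrange (proper_sub ncAV)) mulnC; congr (_ * _)%N.
apply/eqP; rewrite eqn_leq leVp andbT.
have pV := abelem_pgroup abV.
rewrite dvdn_leq ?indexg_gt0 //.
have : p.-nat #|V : 'C_V(A)| by apply: pnat_dvd (dvdn_indexg _ _) pV.
case/p_natP=> -[/eqP | k ->]; last by rewrite expnS dvdn_mulr.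
by rewrite indexg_eq1 => sVC; have := proper_subn ncAV; rewrite sVC.
Qed.

(** Otherwise the fixed points of the conjugates of [A] are hyperplanes of [V]. For the group [Y]
    generated by two distinct conjugates, [V / D] has order p^2, hence at most p + 1 hyperplanes,
    and distinct Sylow p-subgroups of [Y] give distinct ones. Oddness and Sylow's congruence then
    leave a single Sylow subgroup. *)
Lemma prime_index_cent : p < #|V : 'C_V(A)|.
Proof.
rewrite ltnNge; apply/negP=> leVp.
have [x Mx nAx] : exists2 x, x \in M & A :^ x != A.
  apply/exists_inP; rewrite -[X in is_true X]negbK; apply/negP; rewrite negb_exists_in.
  move/forall_inP=> nA; have nAM : M \subset 'N(A).
    by apply/subsetP=> x Mx; apply/normP/eqP; have := nA x Mx; rewrite negbK.
  have : A \subset 'C(M).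
    apply/commG1P/trivgP; rewrite /= -tiMA subsetI commg_subr.
    by rewrite commg_subl nMA.
  move/setIidPl; rewrite cAM => A1.
  by move: p_pr; rewrite -oA -A1 cards1.
have Gx : x \in M <*> A by rewrite mem_gen // inE Mx.
have sAG : A \subset M <*> A by rewrite joing_subr.
have sAxG : A :^ x \subset M <*> A by rewrite -(conjGid Gx) conjSg.
pose Y := (A <*> A :^ x)%G; pose D := 'C_V(Y)%G.
have sYG : Y \subset M <*> A by rewrite join_subG sAG.
have sAY : A \subset Y by rewrite joing_subl.
have sylY (S : {group gT}) : S \in 'Syl_p(Y) -> S \subset M <*> A /\ #|S| = p.
  rewrite inE => sylS; split; first exact: subset_trans (pHall_sub sylS) sYG.
  exact: cardSyl sylS.
have sylA : A \in 'Syl_p(Y).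
  by rewrite inE (pHall_subl sAY sYG) // sylMA.
have sylAx : (A :^ x)%G \in 'Syl_p(Y).
  by rewrite inE (pHall_subl (joing_subr _ _) sYG) // sylMA //= cardJg.
(* If [S] and [T] share their fixed points [C], the group they generate acts quadratically: it maps
   [V] into [C] by commutation and centralises [C]. By [hyper_pgroup] it is a p-group, which forces
   [S = T]. *)
have injC S T : S \in 'Syl_p(Y) -> T \in 'Syl_p(Y) -> 'C_V(S) = 'C_V(T) -> S = T.
  move=> Ssyl Tsyl eqC; set C := ('C_V(S))%G.
  have [[sSG oS] [sTG oT]] := (sylY S Ssyl, sylY T Tsyl).
  have sCV : C \subset V := subsetIl _ _.
  have nCV : V \subset 'N(C) by rewrite sub_abelian_norm ?(abelem_abelian abV).
  have central (U : {group gT}) : U \subset M <*> A -> #|U| = p -> 'C_V(U) = C -> [~: V, U] \subset C.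
    move=> sUG oU eqCU; have nVU : U \subset 'N(V) := subset_trans sUG nVMA.
    have nCU : U \subset 'N(C) by rewrite -eqCU cents_norm // centsC subsetIr.
    have oVC : #|V / C| = p.
      rewrite card_quotient // -divgS // -(cardC leVp sSG oS) mulnK ?cardG_gt0 //.
    have nCVU : V <*> U \subset 'N(C) by rewrite join_subG nCV.
    have pVU : p.-group ((V <*> U) / C).
      apply: quotient_pgroup; rewrite /= norm_joinEr // pgroupM (abelem_pgroup abV).
      by rewrite /pgroup oU pnat_id.
    have nsV : V / C <| (V <*> U) / C.
      by rewrite quotient_normal // /normal joing_subl join_subG normG.
    have ntVC : V / C != 1 by rewrite -cardG_gt1 oVC prime_gt1.
    have := prime_meetG _ (meet_center_nil (pgroup_nil pVU) nsV ntVC).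
    rewrite oVC => /(_ p_pr) sVZ; rewrite -quotient_cents2 //.
    rewrite (subset_trans sVZ) // subIset // centS ?orbT // quotientS ?joing_subr //.
  have nCS : S \subset 'N(C) by rewrite cents_norm // centsC subsetIr.
  have nCT : T \subset 'N(C) by rewrite cents_norm // centsC /= eqC subsetIr.
  have sVZ : [~: V, S <*> T] \subset C.
    rewrite -quotient_cents2 ?join_subG ?nCS // quotientY // centY subsetI.
    by rewrite !quotient_cents2 // !central // eqC.
  have sZY : S <*> T \subset Y.
    by move: Ssyl Tsyl; rewrite !inE join_subG => /pHall_sub-> /pHall_sub->.
  have pZ : p.-group (S <*> T).
    apply: hyper_pgroup sVZ _ => //; first exact: subset_trans sYG.
    by rewrite join_subG !(centsC _ C) subsetIr /= eqC subsetIr.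
  move: Ssyl Tsyl; rewrite !inE => Ssyl Tsyl.
  apply: val_inj; rewrite /= -(sub_pHall Ssyl pZ) ?joing_subl //.
  by rewrite (sub_pHall Tsyl pZ) ?joing_subr.
have oV S : S \in 'Syl_p(Y) -> (p * #|'C_V(S)|)%N = #|V|.
  by case/sylY=> sSG oS; apply: cardC.
have sDC S : S \in 'Syl_p(Y) -> D \subset 'C_V(S).
  by rewrite inE => /pHall_sub sSY; rewrite setIS ?centS.
have neqAAx : A != (A :^ x)%G by rewrite eq_sym.
have leD S T : S \in 'Syl_p(Y) -> T \in 'Syl_p(Y) -> S != T ->
    (p * #|'C_V(S) :&: 'C_V(T)| <= #|'C_V(S)|)%N.
  move=> Ssyl Tsyl neqST; rewrite -(LagrangeI 'C_V(S) 'C_V(T)) mulnC leq_mul2l.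
  apply/orP; right; have := abelem_pgroup abV.
  have: 'C_V(S) :&: 'C_V(T) \proper 'C_V(S).
    rewrite properE subsetIl subsetI subxx /=; apply: contra neqST => sCST.
    apply/eqP/injC => //; apply/eqP; rewrite eqEcard sCST.
    by rewrite -(leq_pmul2l (prime_gt0 p_pr)) !oV //= leqnn.
  move=> ltST pV; have pCS := pgroupS (subsetIl V 'C(S)) pV.
  rewrite -indexgI dvdn_leq ?indexg_gt0 //.
  have : p.-nat #|'C_V(S) : 'C_V(S) :&: 'C_V(T)| by apply: pnat_dvd (dvdn_indexg _ _) pCS.
  case/p_natP=> -[/eqP | k ->]; last by rewrite expnS dvdn_mulr.
  by rewrite indexg_eq1 => sSST; have := proper_subn ltST; rewrite sSST.
pose d := #|D|.
have cardCS S : S \in 'Syl_p(Y) -> #|'C_V(S)| = (p * d)%N.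
  move=> Ssyl; have -> : #|'C_V(S)| = #|'C_V(A)|.
    by apply/eqP; rewrite -(eqn_pmul2l (prime_gt0 p_pr)) !oV.
  have defD : D :=: 'C_V(A) :&: 'C_V(A :^ x).
    by rewrite /D /= centY; apply: setIIr.
  (* One inequality is [leD]; the other bounds the product of the two subgroups ['C_V(A)] and
     ['C_V(A :^ x)] by [V]. *)
  apply/eqP; rewrite eqn_leq /d defD (leD A _ sylA sylAx) // andbT.
  have oVA := oV A sylA; have oVAx := oV _ sylAx.
  have eqAx : #|'C_V(A :^ x)| = #|'C_V(A)|.
    by apply/eqP; rewrite -(eqn_pmul2l (prime_gt0 p_pr)) oVA oVAx.
  rewrite -(leq_pmul2l (cardG_gt0 'C_V(A))) -{2}eqAx mul_cardG mulnCA mulnA.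
  rewrite leq_mul2r /= oVA subset_leq_card ?orbT // mul_subG ?subsetIl //.
have capC S T : S \in 'Syl_p(Y) -> T \in 'Syl_p(Y) -> S != T ->
    'C_V(S) :&: 'C_V(T) = D.
  move=> Ssyl Tsyl neqST; apply/eqP; rewrite eq_sym eqEcard subsetI !sDC //=.
  by rewrite -(leq_pmul2l (prime_gt0 p_pr)) -(cardCS S) ?leD.
(* The sets [F S] are pairwise disjoint, each with p d - d elements, inside the p^2 d - d elements
   of [V] outside [D]: this counts hyperplanes without forming [V / D]. *)
pose F (S : {group gT}) := 'C_V(S) :\: D.
have d_gt0 : 0 < d := cardG_gt0 D.
have cardF S : S \in 'Syl_p(Y) -> #|F S| = (p * d - d)%N.
  by move=> Ssyl; rewrite cardsDS ?sDC // cardCS.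
have pd_gt0 : 0 < p * d - d by rewrite subn_gt0 -{1}(mul1n d) ltn_pmul2r // prime_gt1.
have le_n : (#|'Syl_p(Y)| * (p * d - d) <= p * (p * d) - d)%N.
  have tiF S T : S \in 'Syl_p(Y) -> T \in 'Syl_p(Y) -> S != T -> [disjoint F S & F T].
    by move=> Ssyl Tsyl neqST; rewrite -setI_eq0 /F -setDIl capC // setDv.
  have injF : {in 'Syl_p(Y) &, injective F}.
    move=> S T Ssyl Tsyl eqF; apply/eqP/idPn => neqST.
    have := tiF S T Ssyl Tsyl neqST; rewrite eqF -setI_eq0 setIid -cards_eq0.
    by rewrite cardF // -leqn0 leqNgt pd_gt0.
  have triv : trivIset (F @: 'Syl_p(Y)).
    apply/trivIsetP=> _ _ /imsetP[S Ssyl ->] /imsetP[T Tsyl ->] neqF.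
    by apply: tiF => //; apply: contraNneq neqF => ->.
  have -> : (p * (p * d) = #|V|)%N by rewrite -(cardCS A) ?oV.
  rewrite -(card_in_imset injF) -cardsDS ?subsetIl //.
  rewrite -[leqLHS](card_uniform_partition (n := p * d - d) (P := F @: 'Syl_p(Y)) (D := cover (F @: 'Syl_p(Y)))).
  - apply/subset_leq_card/bigcupsP=> _ /imsetP[S Ssyl ->].
    by rewrite setSD ?subsetIl.
  - by move=> _ /imsetP[S Ssyl ->]; apply: cardF.
  rewrite /partition eqxx triv /=; apply/imsetP=> -[S Ssyl F0].
  by have := cardF S Ssyl; rewrite -F0 cards0 => pd0; rewrite -pd0 in pd_gt0.
have le_np : #|'Syl_p(Y)| <= p.+1.
  rewrite -(leq_pmul2r pd_gt0) (leq_trans le_n) //.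
  by rewrite mulnBr !mulSn (addnC d) subnDl.
(* The number is odd while p + 1 is even, and it is 1 modulo p, so below p only 1 remains. *)
have n1 : #|'Syl_p(Y)| = 1%N.
  have oddn : odd #|'Syl_p(Y)|.
    apply: dvdn_odd (dvdn_trans (card_Syl_dvd p Y) (cardSg sYG)) _.
    by rewrite oMA ssrnat.oddM oddM.
  move: (card_Syl_mod Y p_pr) oddn le_np; set n := #|_| => nmod oddn.
  rewrite leq_eqVlt => /orP[/eqP defn | ]; first by rewrite defn /= odd_p in oddn.
  rewrite ltnS leq_eqVlt => /orP[/eqP defn | ltnp].
    by rewrite defn modnn in nmod.
  by rewrite -nmod modn_small.
have /cards1P[S defS] : #|'Syl_p(Y)| == 1%N by rewrite n1.
move: sylA sylAx; rewrite defS !inE => /eqP defA /eqP defAx.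
have /(congr1 val)/= eqAxA : (A :^ x)%G = A by rewrite defAx defA.
by rewrite eqAxA eqxx in nAx.
Qed.

End PrimeOrder.

(** Induction on |A|. If [A] is not of order p, [abelem2_coprime_cent] gives [x] whose centraliser
    [N] in [M] is not centralised by [A], so [B], which contains [x], is proper and nontrivial, with
    a complement [A0]. The bounds for [B] on [V] and for [A0] on ['C_V(B)] multiply; [N] is faithful
    on ['C_V(B)] by the A x B lemma. *)
Theorem abelem_index_cent V M A :
    p.-abelem V -> p.-abelem A -> p^'.-group M -> odd #|M| -> odd #|A| ->
    M \subset 'N(V) -> A \subset 'N(V) -> A \subset 'N(M) ->
    'C_M(V) = 1 -> 'C_A(M) = 1 -> A :!=: 1 ->
  #|A| < #|V : 'C_V(A)|.
Proof.
have [n] := ubnP #|A|; elim: n V M A => // n IHn V M A; rewrite ltnS => leAn.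
move=> abV abA p'M oddM oddA nVM nVA nMA cMV cAM ntA.
have [p_pr pA0 [k oA]] := pgroup_pdiv (abelem_pgroup abA) ntA.
have pA := abelem_pgroup abA; have pV := abelem_pgroup abV.
have odd_p : odd p by move: oddA; rewrite oA oddX /=.
have [kz | k_gt0] := posnP k.
  by rewrite oA kz expn1 (prime_index_cent abV p'M) // oA kz expn1.
have ltpA : p < #|A| by rewrite oA (ltn_exp2l 1 k.+1 (prime_gt1 p_pr)).
have [x /setD1P[ntx Ax] ncx] : exists2 x, x \in A^# & ~~ ('C_M[x] \subset 'C(A)).
  apply/exists_inP; apply: contraLR ntA; rewrite negb_exists_in negbK => /forall_inP cM.
  rewrite -subG1 -cAM subsetI subxx centsC (abelem2_coprime_cent p_pr abA) // => x Ax.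
  by have := cM x Ax; rewrite negbK.
pose N := 'C_M[x]%G; pose B := 'C_A(N)%G.
have sBA : B \subset A := subsetIl _ _.
have Bx : x \in B by rewrite inE Ax; apply/centP=> y /setIP[_ /cent1P/esym].
have ntB : B :!=: 1 by apply: contraNneq ntx => B1; rewrite B1 inE in Bx.
have prBA : #|B| < #|A|.
  rewrite proper_card // properE sBA; apply: contra ncx => sAB.
  by rewrite centsC (subset_trans sAB) ?subsetIr.
have [A0 /complP[tiBA0 defA]] := splitsP (abelem_splits abA sBA).
have sA0A : A0 \subset A by rewrite -defA mulG_subr.
have cAA := abelem_abelian abA.
have lt1 : #|B| < #|V : 'C_V(B)|.
  apply: (IHn V M B) => //; rewrite ?(abelemS sBA) ?(oddSg sBA) ?(subset_trans sBA) //.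
  - exact: leq_trans prBA leAn.
  - by apply/trivgP; rewrite -cAM setSI.
have sNM : N \subset M := subsetIl _ _.
have cBN : N \subset 'C(B) by rewrite centsC subsetIr.
have nVN := subset_trans sNM nVM.
have nVB := subset_trans sBA nVA.
have p'N : p^'.-group N := pgroupS sNM p'M.
have nCA0 : A0 \subset 'N('C_V(B)).
  rewrite normsI ?(subset_trans sA0A nVA) // norms_cent // cents_norm //.
  by rewrite (subset_trans sA0A) // (subset_trans cAA) // centS.
have oA0 : #|A| = (#|B| * #|A0|)%N by rewrite -defA TI_cardMg.
have lt2 : #|A0| < #|'C_V(B) : 'C_('C_V(B))(A0)|.
  apply: (IHn ('C_V(B))%G N A0) => //=.
  - apply: leq_trans leAn; rewrite oA0 ltn_Pmull ?cardG_gt0 // ltnNge.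
    by rewrite -trivg_card_le1.
  - exact: abelemS (subsetIl _ _) abV.
  - exact: abelemS abA.
  - exact: oddSg oddM.
  - exact: oddSg oddA.
  - by rewrite normsI // norms_cent // cents_norm.
  - rewrite normsI ?(subset_trans sA0A nMA) // -cent_set1 norms_cent // cents_norm //.
    by rewrite (subset_trans sA0A) // (subset_trans cAA) // centS // sub1set.
  - apply/trivgP; rewrite -cMV subsetI (subset_trans (subsetIl _ _) sNM) /= centsC.
    apply: (@AxB_cent _ p B) => //.
    + exact: abelem_abelian abV.
    + exact: pgroupS pA.
    + by rewrite (pgroupS (subsetIl _ _)).
    + by rewrite subIset // nVN.
    + by rewrite subIset // cBN.
    by rewrite centsC subsetIr.
  - by apply/trivgP; rewrite -tiBA0 subsetI subsetIl andbT setSI.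
  apply: contraTneq prBA => A01; rewrite oA0 A01 cards1 muln1 ltnn //.
have <- : 'C_('C_V(B))(A0) = 'C_V(A).
  by rewrite -setIA -centM defA.
by rewrite -(Lagrange_index (subsetIl V 'C(B)) (subsetIl _ 'C(A0))) oA0 ltn_mul.
Qed.

End QuadraticIndex.

(** As [U] centralises [V], conjugation induces an action of quotients by [U] on [V]. The bound is
    applied in the semidirect product for this action, where [V], [M / U] and [A / U] become
    subgroups of one group. *)
Lemma abelem_index_cent_quotient (gT : finGroupType) (p : nat)
    (U V M A : {group gT}) :
    p.-abelem V -> p.-abelem (A / U) -> p^'.-group (M / U) ->
    odd #|M| -> odd #|A| -> U \subset 'C(V) ->
    M \subset 'N(U) -> A \subset 'N(U) -> M \subset 'N(V) -> A \subset 'N(V) ->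
    A \subset 'N(M) -> 'C_M(V) \subset U -> 'C_(A / U)(M / U) = 1 -> A / U != 1 ->
  #|A / U| < #|V : 'C_V(A)|.
Proof.
move=> abV abA p'M oddM oddA cVU nUM nUA nVM nVA nMA cMV cAM ntA.
pose to := ('J %% U)%gact.
have sVR : V \subset 'C_(|'J)(U) by rewrite gacentJ centsC.
have sD (B : {group gT}) : B \subset 'N(U) -> B / U \subset setT / U by move=> nUB; rewrite quotientS ?subsetT.
have cVU' : U \subset 'C(V | 'J) by rewrite astabJ.
pose f1 := sdpair1_morphism to; pose f2 := sdpair2_morphism to.
have inj1 : 'injm f1 := injm_sdpair1 to.
have inj2 : 'injm f2 := injm_sdpair2 to.
have actsV (B : {group gT}) : B \subset 'N(U) -> B \subset 'N(V) -> f2 @* (B / U) \subset 'N(f1 @* V).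
  move=> nUB nVB; rewrite -actsEsd ?sD //=.
  by rewrite astabs_mod ?quotientS //= astabsJ.
have capV (B : {group gT}) : B \subset 'N(U) -> 'C_(f1 @* V)(f2 @* (B / U)) = f1 @* 'C_V(B).
  move=> nUB; rewrite -[in RHS]gacentJ -(gacent_mod cVU' nUB).
  have -> : 'C_(V | 'J %% U)(B / U) = V :&: f1 @*^-1 'C(f2 @* (B / U)).
    by rewrite -gacentEsd ?sD.
  by rewrite morphim_setIpre.
have -> : #|A / U| = #|f2 @* (A / U)| by rewrite card_injm ?sD.
have -> : #|V : 'C_V(A)| = #|f1 @* V : 'C_(f1 @* V)(f2 @* (A / U))|.
  by rewrite capV // index_injm ?subsetIl.
apply: (@abelem_index_cent _ p (f1 @* V)%G (f2 @* (M / U))%G (f2 @* (A / U))%G) => //=.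
- exact: morphim_abelem.
- exact: morphim_abelem.
- exact: morphim_pgroup.
- by rewrite card_injm ?sD // (dvdn_odd (dvdn_quotient _ _)).
- by rewrite card_injm ?sD // (dvdn_odd (dvdn_quotient _ _)).
- exact: actsV.
- exact: actsV.
- by rewrite morphim_norms ?quotient_norms.
- rewrite -morphim_setIpre -astabEsd ?sVR // astab_mod // astabJ.
  by rewrite -quotientIG // quotientS1 ?morphim1.
- by rewrite -injm_subcent ?sD // cAM morphim1.
by rewrite morphim_injm_eq1 ?sD.
Qed.

(** * Thompson's criterion for p-nilpotency in odd order *)

Section ThompsonHelpers.

Variables (gT : finGroupType) (p : nat).
Implicit Types (G H K M P X : {group gT}).

Lemma charJ X P g : X \char P -> X :^ g \char P :^ g.
Proof.
move=> chXP; have := injm_char (injm_conj [set: gT] g) (subsetT P) chXP.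
by rewrite !morphim_conj !setTI.
Qed.

Lemma pnilpotentJ G g : pnilpotent p (G :^ g) = pnilpotent p G.
Proof. by rewrite /pnilpotent pcoreJ indexJg. Qed.

Lemma pnilpotent_quotient M G : G \subset 'N(M) -> pnilpotent p G -> pnilpotent p (G / M).
Proof.
move=> nMG pnG; apply: (@pnilpotent_normal _ _ _ ('O_p^'(G) / M)).
- by rewrite quotient_normal ?pcore_normal.
- by rewrite quotient_pgroup ?pcore_pgroup.
by apply: pnat_dvd pnG; rewrite index_quotient // subIset // nMG.
Qed.

Lemma pnilpotent_quotient_p' M G :
  M <| G -> p^'.-group M -> pnilpotent p (G / M) -> pnilpotent p G.
Proof.
move=> nsMG p'M pnGM.
have [N defN sMN nsNG] := inv_quotientN nsMG (pcore_normal p^' (G / M)).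
apply: (@pnilpotent_normal _ _ _ N) => //.
  rewrite -(pquotient_pgroup p'M) -?defN ?pcore_pgroup //.
  by rewrite (subset_trans (normal_sub nsNG)) ?normal_norm.
have nNM : G :&: M \subset N by rewrite subIset // sMN orbT.
by rewrite -(index_quotient_eq nNM) ?normal_norm ?normal_sub //= -defN.
Qed.

Lemma pnilpotent_pgroup G : pnilpotent p G -> 'O_p^'(G) = 1 -> p.-group G.
Proof. by rewrite /pnilpotent => + G1; rewrite G1 indexg1. Qed.

(** [X] is a Sylow p-subgroup of [M <*> X], so the Frattini argument applies in the normaliser of
    [M <*> X]. *)
Lemma norm_quotient_p' M G X :
    M <| G -> p^'.-group M -> p.-group X -> X \subset G ->
  'N_(G / M)(X / M) = 'N_G(X) / M.
Proof.
move=> nsMG p'M pX sXG; have [sMG nMG] := andP nsMG.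
have nMX := subset_trans sXG nMG.
apply/eqP; rewrite eqEsubset; apply/andP; split; last first.
  by rewrite subsetI quotientS ?subsetIl // quotient_norms ?subsetIr.
have nsMXM : M <| M <*> X by rewrite /normal joing_subl join_subG normG.
have sXM : M <*> X \subset G by rewrite join_subG sMG.
have -> : X / M = (M <*> X) / M by rewrite quotientYidl.
rewrite -quotient_normG // -quotientGI // -/('N_G(M <*> X)).
have nsYN : M <*> X <| 'N_G(M <*> X) by rewrite normalSG.
have sylX : p.-Sylow(M <*> X) X.
  rewrite /pHall joing_subr pX -divgS ?joing_subr //= norm_joinEr //.
  rewrite coprime_cardMg ?mulnK ?cardG_gt0 //.
  by rewrite coprime_sym (pnat_coprime pX).
rewrite -(Frattini_arg nsYN sylX) quotientMl; last by rewrite join_subG normG.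
rewrite quotientYidl // mul_subG ?quotientS //.
  by rewrite subsetI sXG normG.
by rewrite setSI // subsetIl.
Qed.

End ThompsonHelpers.

Lemma char_quotient_TI (gT : finGroupType) (M P : {group gT}) (Xb : {group coset_of M}) :
    P \subset 'N(M) -> P :&: M = 1 -> Xb \char P / M ->
  exists X : {group gT}, X \char P /\ Xb :=: X / M.
Proof.
move=> nMP tiPM chX; pose f := restrm_morphism nMP (coset_morphism M).
have injf : 'injm f by rewrite ker_restrm ker_coset tiPM.
have imf (X : {group gT}) : X \subset P -> f @* X = X / M.
  by move=> sXP; rewrite morphim_restrm (setIidPr sXP).
have chX1 : Xb \char f @* P by have := imf P (subxx _) => ->.
have chX2 := injm_char (injm_invm injf) (subxx _) chX1.
have sXP : invm injf @* Xb \subset P.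
  by rewrite (subset_trans (morphimS _ (char_sub chX1))) // im_invm.
exists (invm injf @* Xb)%G; split=> /=; first by rewrite im_invm in chX2.
rewrite -[RHS](imf _ sXP) -(morphpre_invm injf) morphimK ?injm_invm //; last exact: char_sub chX1.
by rewrite (trivgP (injm_invm injf)) mul1g.
Qed.

(** This is the elementary abelian version of the Thompson subgroup J(P). *)
Lemma gen_max_rank_char (gT : finGroupType) (p : nat) (P : {group gT}) :
  <<\bigcup_(E in 'E_p^('r_p(P))(P)) E>> \char P.
Proof.
set r := 'r_p(P); apply/charP; split.
  by rewrite gen_subG; apply/bigcupsP=> E /pnElemP[].
move=> f injf imf; apply/eqP; rewrite eqEcard card_injm ?leqnn ?andbT //; last first.
  by rewrite gen_subG; apply/bigcupsP=> E /pnElemP[].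
rewrite morphim_gen; last by apply/bigcupsP=> E /pnElemP[].
rewrite gen_subG; apply/subsetP=> _ /morphimP[x Px /bigcupP[E EP Ex] ->].
apply/mem_gen/bigcupP; exists (f @* E)%G.
  by rewrite -{2}imf injm_pnElem //; case/pnElemP: EP.
by rewrite mem_morphim.
Qed.

Section ThompsonStep.

Variables (gT : finGroupType) (p : nat) (G P : {group gT}).
Local Notation U := 'O_p(G).
Hypotheses (oddG : odd #|G|) (sylP : p.-Sylow(G) P) (ntP : P :!=: 1).
Hypothesis pnN : forall X : {group gT}, X \char P -> X :!=: 1 -> pnilpotent p 'N_G(X).
Hypotheses (p'G1 : 'O_p^'(G) = 1) (pnGU : pnilpotent p (G / U)).

Let sPG : P \subset G. Proof. exact: pHall_sub sylP. Qed.
Let pP : p.-group P. Proof. exact: pHall_pgroup sylP. Qed.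
Let sUP : U \subset P. Proof. by rewrite pcore_sub_Hall. Qed.
Let pU : p.-group U. Proof. exact: pcore_pgroup. Qed.
Let nsUG : U <| G. Proof. exact: pcore_normal. Qed.

Let M := (coset U @*^-1 'O_p^'(G / U) :&: G)%G.
Let defMU : M / U = 'O_p^'(G / U).
Proof.
have [N defN sUN nsNG] := inv_quotientN nsUG (pcore_normal p^' (G / U)).
rewrite /M /= defN quotientGK ?(normalS sUN (normal_sub nsNG)) //.
by rewrite (setIidPl (normal_sub nsNG)).
Qed.
Let MN : exists2 N : {group gT}, M :=: N & U \subset N /\ N <| G.
Proof.
have [N defN sUN nsNG] := inv_quotientN nsUG (pcore_normal p^' (G / U)).
exists N => //; rewrite /M /= defN quotientGK ?(normalS sUN (normal_sub nsNG)) //.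
by rewrite (setIidPl (normal_sub nsNG)).
Qed.
Let sUM : U \subset M. Proof. by have [N -> []] := MN. Qed.
Let nsMG : M <| G. Proof. by rewrite /normal; have [N -> []] := MN. Qed.
Let p'MU : p^'.-group (M / U). Proof. by rewrite defMU pcore_pgroup. Qed.

Let normal_pnil (H : {group gT}) : H <| G -> pnilpotent p H -> H \subset U.
Proof.
move=> nsHG pnH; rewrite pcore_max //; apply: pnilpotent_pgroup pnH _.
apply/trivgP; rewrite -p'G1 pcore_max ?pcore_pgroup //.
exact: gFnormal_trans nsHG.
Qed.

(** In [C] the subgroup [U :&: C] is a central Sylow p-subgroup, so its Schur-Zassenhaus complement
    is normal and [C] is p-nilpotent; [normal_pnil] concludes. *)
Let cMU : 'C_M(U) \subset U.
Proof.
set C := 'C_M(U)%G; have nsCG : C <| G.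
  rewrite /C /normal /= subIset ?(normal_sub nsMG) //=.
  by rewrite normsI ?norms_cent ?normal_norm.
apply: normal_pnil => //.
have nUC : C \subset 'N(U) := subset_trans (normal_sub nsCG) (normal_norm nsUG).
have nsZC : U :&: C <| C by rewrite /normal subsetIr normsI ?normG.
have pZ : p.-group (U :&: C) := pgroupS (subsetIl _ _) pU.
have p'CZ : p^'.-nat #|C : U :&: C|.
  rewrite setIC indexgI -card_quotient //.
  by apply: pgroupS p'MU; rewrite quotientS ?subsetIl.
have hallZ : Hall C (U :&: C) by rewrite /Hall subsetIr (pnat_coprime pZ).
have [L /complP[tiZL defC]] := splitsP (SchurZassenhaus_split hallZ nsZC).
have sLC : L \subset C by rewrite -defC mulG_subr.
have cLZ : L \subset 'C(U :&: C).
  by rewrite (subset_trans sLC) // centsC (subset_trans (subsetIl _ _)) // centsC subsetIr.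
apply: (@pnilpotent_normal _ _ _ L).
- rewrite /normal sLC /= -{1}defC mul_subG ?normG // cents_norm // centsC //.
- by move: p'CZ; rewrite -divgS ?subsetIr // -{1}defC TI_cardMg // mulKn.
by rewrite -divgS // -{1}defC TI_cardMg // mulnK.
Qed.

(** The image of ['C_G(U)] in [G / U] is p-nilpotent, and its p'-core comes from ['C_M(U)], so is
    trivial. It is thus a normal p-subgroup of [G / U], whose p-core is trivial. *)
Let cGU : 'C_G(U) \subset U.
Proof.
have nsCG : 'C_G(U) <| G by rewrite /normal subsetIl normsI ?normG // norms_cent ?normal_norm.
have nUC : 'C_G(U) \subset 'N(U) := subset_trans (normal_sub nsCG) (normal_norm nsUG).
rewrite -quotient_sub1 // -(trivg_pcore_quotient p G) pcore_max ?quotient_normal //.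
apply: pnilpotent_pgroup; first exact: pnilpotentS (quotientS _ (subsetIl _ _)) pnGU.
apply/trivgP; apply: subset_trans (_ : M / U :&: 'C_G(U) / U \subset _).
  rewrite subsetI gFsub andbT defMU pcore_max ?pcore_pgroup //.
  by rewrite gFnormal_trans ?quotient_normal.
rewrite -quotientGI // setIA (setIidPl (normal_sub nsMG)).
by rewrite (subset_trans (quotientS U cMU)) // trivg_quotient.
Qed.

Let V := 'Ohm_1('Z(U))%G.

Let nsVG : V <| G.
Proof. by rewrite !gFnormal_trans. Qed.

(** By [cGU] the centre of [P] lies in that of [U], so [V] contains ['Ohm_1('Z(P))], whose
    normaliser is p-nilpotent by hypothesis and contains ['C_G(V)]. *)
Let cGV : 'C_G(V) \subset U.
Proof.
have sZPU : 'Z(P) \subset U.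
  rewrite (subset_trans _ cGU) // subsetI (subset_trans (center_sub P) sPG).
  by rewrite subIset // centS ?orbT.
have sZZ : 'Z(P) \subset 'Z(U) by rewrite subsetI sZPU subIset // centS ?orbT.
have sWV : 'Ohm_1('Z(P)) \subset V by rewrite OhmS.
apply: normal_pnil.
  by rewrite /normal subsetIl normsI ?normG // norms_cent ?normal_norm.
apply: pnilpotentS (pnN (X := 'Ohm_1('Z(P))%G) _ _).
- by rewrite setIS //= (subset_trans (centS sWV)) ?cent_sub.
- exact: gFchar_trans (center_char P).
by rewrite Ohm1_eq1 (center_nil_eq1 (pgroup_nil pP)).
Qed.

(** If all subgroups of maximal rank lay in [U], conjugation by [G] would permute them; [J],
    characteristic in [P], would be normal in [G], and [pnN] would make [G] p-nilpotent. *)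
Let exists_max_rank : ~~ pnilpotent p G -> exists2 A : {group gT},
  A \in 'E_p^('r_p(P))(P) & ~~ (A \subset U).
Proof.
move=> npG; apply/exists_inP; apply: contraR npG; rewrite negb_exists_in => /forall_inP sEU'.
have sEU (E : {group gT}) : E \in 'E_p^('r_p(P))(P) -> E \subset U.
  by move=> /sEU'; rewrite negbK.
set J := << \bigcup_(E in 'E_p^('r_p(P))(P)) E >>%G.
have chJP : J \char P := gen_max_rank_char p P.
suffices nJG : 'N_G(J) = G.
  rewrite -nJG pnN //; have [E EP] := p_rank_witness p P.
  have r_gt0 : 0 < 'r_p(P).
    have [p_pr pP_dvd _] := pgroup_pdiv pP ntP.
    by rewrite p_rank_gt0 mem_primes p_pr cardG_gt0.
  have sEJ : E \subset J by rewrite sub_gen // (bigcup_max E).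
  apply: contraTneq r_gt0 => J1; rewrite J1 in sEJ; case/pnElemP: EP => _ _ <-.
  by rewrite (trivgP sEJ) cards1 logn1.
apply/setIidPl/subsetP=> g Gg; rewrite inE -genJ gen_subG.
apply/subsetP=> _ /imsetP[x /bigcupP[E EP Ex] ->]; apply/mem_gen/bigcupP.
exists (E :^ g)%G; last by rewrite memJ_conjg.
have sEgP : E :^ g \subset P.
  by rewrite (subset_trans _ sUP) // -(normsP (normal_norm nsUG) g Gg) conjSg sEU.
case/pnElemP: EP => _ abE logE.
by apply/pnElemP; split; rewrite ?abelemJ ?cardJg.
Qed.

(** An [A] of maximal rank outside [U] acts nontrivially on [M / U], so the index bound applies on
    [V]. Replacing [A] by the product of [A :&: U] and [V] would then increase its order, against
    maximality. *)
Lemma thompson_step : pnilpotent p G.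
Proof.
apply: contraT => npG.
have [A /pnElemP[sAP abA logA] nsAU] := exists_max_rank npG.
have pV : p.-abelem V by rewrite Ohm1_abelem ?center_abelian // (pgroupS (center_sub _)).
have sVU : V \subset U by rewrite (subset_trans (Ohm_sub _ _)) ?center_sub.
have cVU : U \subset 'C(V).
  by rewrite centsC (subset_trans (Ohm_sub _ _)) //; apply: subsetIr.
have sAG := subset_trans sAP sPG.
have [nUG nMG nVG] := And3 (normal_norm nsUG) (normal_norm nsMG) (normal_norm nsVG).
have sMG := normal_sub nsMG.
have : #|A / U| < #|V : 'C_V(A)|.
  apply: (@abelem_index_cent_quotient _ p U V M A) => //.
  - exact: quotient_abelem.
  - exact: oddSg oddG.
  - exact: oddSg oddG.
  - exact: subset_trans nUG.
  - exact: subset_trans nUG.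
  - exact: subset_trans nVG.
  - exact: subset_trans nVG.
  - exact: subset_trans nMG.
  - by rewrite (subset_trans _ cGV) // setSI.
  (* The centraliser of [M / U] in [P / U] is normalised by both factors of [G / U], so it is a
     normal p-subgroup and trivial. *)
  - apply/trivgP; apply: subset_trans (_ : 'C_(P / U)(M / U) \subset _).
      by rewrite setSI ?quotientS.
    rewrite -(trivg_pcore_quotient p G) pcore_max //.
      by rewrite (pgroupS (subsetIl _ _)) ?quotient_pgroup.
    rewrite /normal subIset ?quotientS //=.
    have sylPU : p.-Sylow(G / U) (P / U).
      by rewrite quotient_pHall // (subset_trans sPG).
    have defGU : (M / U) * (P / U) = G / U.
      by rewrite defMU (pnilpotent_sylow_mul pnGU).
    rewrite -{1}defGU mul_subG //.
      by rewrite cents_norm // centsC subsetIr.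
    rewrite normsI ?normG // norms_cent //.
    by rewrite quotient_norms // (subset_trans sPG).
  by rewrite -subG1 quotient_sub1 // (subset_trans sAG).
rewrite ltnNge; case/negP.
have nUA := subset_trans sAG nUG.
have cAA := abelem_abelian abA.
pose E := ((A :&: U) <*> V)%G.
have cVAU : V \subset 'C(A :&: U) by rewrite centsC (subset_trans (subsetIr _ _)).
have abE : p.-abelem E.
  by rewrite (cprod_abelem p (cprodEY _)) ?(abelemS (subsetIl _ _)) // centsC.
have leEA : #|E| <= #|A|.
  have := @logn_le_p_rank _ p P E; rewrite inE abE andbT.
  rewrite join_subG (subset_trans sVU) // subIset ?sAP //= => /(_ isT).
  rewrite -logA => le_log.
  rewrite (card_pgroup (abelem_pgroup abE)) (card_pgroup (abelem_pgroup abA)).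
  by rewrite leq_pexp2l // prime_gt0 //; case: (pgroup_pdiv pP ntP).
have sCV : A :&: U :&: V \subset 'C_V(A).
  by rewrite subsetI subsetIr (subset_trans (subsetIl _ _)) // (subset_trans (subsetIl _ _)).
rewrite -(leq_pmul2r (cardG_gt0 'C_V(A))) mulnC Lagrange ?subsetIl //.
rewrite card_quotient // -indexgI -(leq_pmul2l (cardG_gt0 (A :&: U))) mulnA.
rewrite Lagrange ?subsetIl //; apply: leq_trans (leq_mul leEA (subset_leq_card sCV)).
rewrite /E /= cent_joinEr // -mul_cardG leqnn //.
Qed.

End ThompsonStep.

(** Induction on |G| reduces to the situation of [thompson_step]: trivial p'-core, and a p-nilpotent
    quotient by the p-core. *)
Theorem thompson_pnilpotent (gT : finGroupType) (p : nat) (G P : {group gT}) :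
    odd #|G| -> p.-Sylow(G) P ->
    (forall X : {group gT}, X \char P -> X :!=: 1 -> pnilpotent p 'N_G(X)) ->
  pnilpotent p G.
Proof.
have [n] := ubnP #|G|; elim: n gT G P => // n IHn gT G P; rewrite ltnS => leGn oddG sylP pnN.
have [sPG pP _] := and3P sylP.
have [P1 | ntP] := eqsVneq P 1.
  apply: (@pnilpotent_normal _ _ G G); rewrite ?normal_refl ?indexgg //.
  by rewrite /pgroup -partn_eq1 // -(card_Hall sylP) P1 cards1.
have [p_pr _ _] := pgroup_pdiv pP ntP.
have pnNS (S X : {group gT}) : p.-Sylow(G) S -> X \char S -> X :!=: 1 -> pnilpotent p 'N_G(X).
  move=> sylS chX ntX; have [g Gg defP] := Sylow_trans sylS sylP.
  rewrite -(pnilpotentJ _ _ g) conjIg conjGid // -normJ.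
  apply: (pnN (X :^ g)%G) => /=; first by rewrite defP charJ.
  by rewrite -(inj_eq (@conjsg_inj _ g)) conjs1g in ntX *.
have [p'G1 | ntp'] := eqVneq 'O_p^'(G) 1; last first.
  apply: pnilpotent_quotient_p' (pcore_normal p^' G) (pcore_pgroup p^' G) _.
  have nOP : P \subset 'N('O_p^'(G)) by rewrite (subset_trans sPG) ?gFnorm.
  have tiPO : P :&: 'O_p^'(G) = 1.
    by rewrite coprime_TIg // (pnat_coprime pP) // -/(_.-group _) pcore_pgroup.
  apply: (IHn _ _ (P / 'O_p^'(G))%G).
  - by apply: leq_trans leGn; rewrite ltn_quotient ?gFsub.
  - by rewrite (dvdn_odd (dvdn_quotient _ _)).
  - by rewrite quotient_pHall.
  move=> Xb chX ntX; have [X [chXP defX]] := char_quotient_TI nOP tiPO chX.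
  have sXP := char_sub chXP.
  have sXG := subset_trans sXP sPG.
  rewrite defX (norm_quotient_p' (pcore_normal _ G) (pcore_pgroup _ G) (pgroupS sXP pP) sXG).
  apply: pnilpotent_quotient; first exact: subset_trans (subsetIl _ _) (gFnorm _ _).
  apply: pnN => //; apply: contraNneq ntX => X1.
  by rewrite defX X1 quotient1.
have pnsub (N : {group gT}) : N \proper G -> P \subset N -> pnilpotent p N.
  move=> prN sPN; have sNG := proper_sub prN.
  apply: (IHn _ _ P); first exact: leq_trans (proper_card prN) leGn.
  - exact: oddSg oddG.
  - exact: pHall_subl sylP.
  by move=> X chX ntX; apply: pnilpotentS (pnN X chX ntX); rewrite setSI.
apply/idPn=> npG.
have [X0 X0P] : exists X : {group gT}, [&& X \subset G, p.-group X, X :!=: 1 & ~~ pnilpotent p 'N_G(X)].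
  apply/existsP; apply: contraR npG; rewrite negb_exists => /forallP npX.
  apply: frobenius_pnilpotent => X sXG pX ntX.
  by have := npX X; rewrite sXG pX ntX /= negbK.
(* Among the p-subgroups violating Frobenius's criterion, take [X] whose normaliser has the largest
   p-part. If that normaliser were proper, induction would need only the subgroups [Y]
   characteristic in its Sylow subgroup [P1]; a violating [Y] would by maximality make [P1]
   self-normalising in [S], hence Sylow in [G], against [pnNS]. So [X] is normal. *)
have ntU : 'O_p(G) != 1.
  pose bad (X : {group gT}) :=
    [&& X \subset G, p.-group X, X :!=: 1 & ~~ pnilpotent p 'N_G(X)].
  have [X] := @arg_maxnP _ X0 bad (fun X : {group gT} => (#|'N_G(X)|`_p)%N) X0P.
  case/and4P=> sXG pX ntX npX maxX.
  suffices nXG : 'N_G(X) = G.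
    apply: contraNneq ntX => U1; rewrite -subG1 -U1 pcore_max //.
    by rewrite /normal sXG -nXG subsetIr.
  apply: contraNeq npX => neqN.
  have prN : 'N_G(X) \proper G by rewrite properEneq neqN subsetIl.
  have [P1 sylP1] := Sylow_exists p 'N_G(X).
  have [sP1N pP1 _] := and3P sylP1.
  apply: (IHn _ _ P1) => //; first exact: leq_trans (proper_card prN) leGn.
    exact: oddSg (subsetIl _ _) oddG.
  move=> Y chY ntY; apply: pnilpotentS (setSI _ (subsetIl _ _)) _.
  apply: contraT => npY; have sYP1 := char_sub chY.
  have sP1G := subset_trans sP1N (subsetIl _ _).
  have [S sylS sP1S] := Sylow_superset sP1G pP1.
  have [sSG pS _] := and3P sylS.
  have := maxX Y; rewrite /bad (subset_trans sYP1) // (pgroupS sYP1) // ntY npY.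
  move=> /(_ isT); rewrite -(card_Hall sylP1) /= => leY.
  have sNSP1 : 'N_S(P1) \subset P1.
    suffices -> : 'N_S(P1) = P1 by [].
    apply/eqP; rewrite eq_sym eqEcard subsetI sP1S normG /= (leq_trans _ leY) //.
    have pNS : p.-group 'N_S(P1) := pgroupS (subsetIl _ _) pS.
    rewrite -(part_pnat_id pNS) dvdn_leq ?part_gt0 // partn_dvd ?cardG_gt0 // cardSg //.
    by rewrite setISS ?char_norms.
  have eqSP1 := nilpotent_sub_norm (pgroup_nil pS) sP1S sNSP1.
  by rewrite (pnNS P1 Y) // in npY; rewrite eqSP1 in sylS *.
(* The preimage [Y] of a nontrivial characteristic subgroup of the quotient Sylow group exceeds the
   p-core, so its normaliser is proper; it contains [P], and [pnsub] applies. *)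
have pnGU : pnilpotent p (G / 'O_p(G)).
  have nsUG := pcore_normal p G.
  apply: (IHn _ _ (P / 'O_p(G))%G).
  - by apply: leq_trans leGn; rewrite ltn_quotient ?gFsub.
  - by rewrite (dvdn_odd (dvdn_quotient _ _)).
  - by rewrite quotient_pHall // (subset_trans sPG) ?gFnorm.
  move=> Yb chY ntY; have nsUP : 'O_p(G) <| P.
    exact: normalS (pcore_sub_Hall sylP) sPG nsUG.
  have [Y defY sUY nsYP] := inv_quotientN nsUP (char_normal chY).
  have nsUY : 'O_p(G) <| Y.
    by rewrite (normalS sUY _ nsUG) // (subset_trans (normal_sub nsYP)).
  rewrite defY -quotient_normG // -quotientGI ?normal_sub //.
  apply: pnilpotent_quotient.
    exact: subset_trans (subsetIl _ _) (normal_norm nsUG).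
  apply: pnsub; last by rewrite subsetI sPG normal_norm.
  rewrite properEneq subsetIl andbT; apply: contraNneq ntY => NYG.
  rewrite -subG1 defY quotient_sub1 ?(subset_trans (normal_sub nsUY)) ?normal_norm //.
  rewrite pcore_max ?(pgroupS (normal_sub nsYP)) //.
  by rewrite /normal (subset_trans (normal_sub nsYP)) //= -NYG subsetIr.
by case/negP: npG; apply: (thompson_step oddG sylP ntP pnN p'G1 pnGU).
Qed.

(** * Nilpotency of a group of odd order with a semiregular solvable operator group *)

Lemma nilpotent_pnilpotent (gT : finGroupType) (p : nat) (G : {group gT}) :
  nilpotent G -> pnilpotent p G.
Proof.
move=> nilG; have := nilpotent_pcore_Hall p^' nilG.
by case/and3P=> _ _; rewrite pnatNK.
Qed.

Lemma semiregular_quotient (gT : finGroupType) (K A N : {group gT}) :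
    A \subset 'N(K) -> A \subset 'N(N) -> N \subset K -> coprime #|K| #|A| ->
    solvable N -> semiregular K A ->
  semiregular (K / N) (A / N).
Proof.
move=> nKA nNA sNK copKA solN regA xb /setD1P[ntx /morphimP[x Nx Ax defx]].
have Ax' : x \in A^#.
  by rewrite !inE Ax andbT; apply: contraNneq ntx => x1; rewrite defx x1 morph1.
rewrite defx -cent_cycle -quotient_cycle // -strongest_coprime_quotient_cent.
- by rewrite cent_cycle regA // quotient1.
- by rewrite cycle_subG.
- by rewrite subIset // sNK.
- rewrite (coprimeSg (subsetIl _ _)) // (coprimeSg sNK) //.
  by rewrite (coprime_dvdr _ copKA) // order_dvdG.
by rewrite (solvableS (subsetIl _ _)).
Qed.

Section SemiregularNilpotent.

Variables (gT : finGroupType) (K A : {group gT}).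
Hypotheses (nKA : A \subset 'N(K)) (regA : semiregular K A) (ntA : A :!=: 1).
Hypothesis solA : solvable A.

Let copKA : coprime #|K| #|A|. Proof. exact: regular_norm_coprime. Qed.

(** For q different from p, an [A]-invariant Sylow q-subgroup [Q] centralises [N], by
    [Frobenius_act_cent] for [Q <*> A]. So the nontrivial intersection of [N] with the centre of [P]
    is central in [K]. *)
Lemma semiregular_pcore_center (p : nat) : 'O_p(K) != 1 -> 'Z(K) != 1.
Proof.
move=> ntU; set N := 'Ohm_1('Z('O_p(K)))%G.
have pU := pcore_pgroup p K.
have sNU : N \subset 'O_p(K) := subset_trans (Ohm_sub _ _) (center_sub _).
have sNK : N \subset K := subset_trans sNU (pcore_sub _ _).
have ntN : N :!=: 1 by rewrite Ohm1_eq1 (center_nil_eq1 (pgroup_nil pU)).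
have abN : abelian N := abelianS (Ohm_sub _ _) (center_abelian _).
have pN : p.-group N := pgroupS sNU pU.
have chNK : N \char K by rewrite !gFchar_trans ?gFchar.
have [P sylP] := Sylow_exists p K.
have sNP : N \subset P by rewrite (subset_trans sNU) // pcore_sub_Hall.
have sPK := pHall_sub sylP.
have nsNP : N <| P := normalS sNP sPK (char_normal chNK).
have ntZ := meet_center_nil (pgroup_nil (pHall_pgroup sylP)) nsNP ntN.
apply: contraNneq ntZ => ZK1; rewrite -subG1 -ZK1 subsetI subIset ?sNK //=.
rewrite centsC; apply/setIidPl/eqP; rewrite eqEcard subsetIl dvdn_leq //.
apply/dvdn_partP=> // q _; have [-> | neqqp] := eqVneq q p.
  rewrite -(card_Hall sylP) cardSg // subsetI sPK centsC.
  by rewrite (subset_trans (subsetIr _ _)) // subsetIr.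
have [Q sylQ nQA] := sol_coprime_Sylow_exists q solA nKA copKA.
rewrite -(card_Hall sylQ) cardSg // subsetI (pHall_sub sylQ) /=.
rewrite centsC (subset_trans (subsetIl _ _)) //.
have [-> | ntQ] := eqsVneq Q 1; first exact: cents1.
have sQK := pHall_sub sylQ.
have frob : [Frobenius Q <*> A = Q ><| A].
  apply/Frobenius_semiregularP=> //; last exact: semiregularS regA.
  by rewrite sdprodEY // coprime_TIg // (coprimeSg sQK).
apply: (Frobenius_act_cent frob) => //.
- by rewrite join_subG (subset_trans sQK (char_norm chNK)) (char_norm_trans chNK).
- rewrite (pnat_coprime pN) //; apply: pi_pnat (pHall_pgroup sylQ) _.
  by rewrite !inE.
by apply/trivgP; rewrite -(cent_semiregular regA (subxx _) ntA) setSI.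
Qed.

End SemiregularNilpotent.

(** A nontrivial p-core gives a nontrivial centre, and induction applies to [K / 'Z(K)]. If the
    p-core is trivial, the normalisers in Thompson's criterion are proper and [A]-invariant, hence
    nilpotent by induction; the resulting normal p-complement is nilpotent and provides a nontrivial
    q-core. *)
Theorem odd_semiregular_nil (gT : finGroupType) (K A : {group gT}) :
    odd #|K| -> A \subset 'N(K) -> semiregular K A -> A :!=: 1 -> solvable A ->
  nilpotent K.
Proof.
have [n] := ubnP #|K|; elim: n gT K A => // n IHn gT K A; rewrite ltnS => leKn.
move=> oddK nKA regA ntA solA.
have copKA : coprime #|K| #|A| := regular_norm_coprime nKA regA.
have [-> | ntK] := eqsVneq K 1; first exact: nilpotent1.
have IHsub (L : {group gT}) : L \proper K -> A \subset 'N(L) -> nilpotent L.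
  move=> prL nLA; apply: (IHn _ L A) => //.
  - exact: leq_trans (proper_card prL) leKn.
  - exact: oddSg (proper_sub prL) oddK.
  exact: semiregularS (proper_sub prL) (subxx _) regA.
suffices ntZ : 'Z(K) != 1.
  have nZA : A \subset 'N('Z(K)) by rewrite gFnorm_trans.
  rewrite -quotient_center_nil; apply: (IHn _ _ (A / 'Z(K))%G).
  - by apply: leq_trans leKn; rewrite ltn_quotient ?center_sub.
  - by rewrite (dvdn_odd (dvdn_quotient _ _)).
  - exact: quotient_norms.
  - by apply: semiregular_quotient; rewrite ?center_sub ?abelian_sol ?center_abelian.
  - rewrite -subG1 quotient_sub1 //; apply: contra ntA => sAZ.
    rewrite -subG1 -(coprime_TIg copKA) subsetI subxx andbT.
    exact: subset_trans sAZ (center_sub _).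
  exact: quotient_sol.
suffices [p ntOp] : exists p : nat, 'O_p(K) != 1 by exact: (semiregular_pcore_center nKA regA ntA solA ntOp).
have exp (L : {group gT}) : L :!=: 1 -> exists2 p, prime p & p %| #|L|.
  by rewrite -cardG_gt1 => L_gt1; exists (pdiv #|L|); rewrite ?pdiv_prime ?pdiv_dvd.
have [p p_pr p_dv] := exp K ntK.
have [Op1 | ntOp] := eqVneq 'O_p(K) 1; last by exists p.
have [P sylP nPA] := sol_coprime_Sylow_exists p solA nKA copKA.
have [sPK pP _] := and3P sylP.
have pnK : pnilpotent p K.
  apply: (thompson_pnilpotent oddK sylP) => X chX ntX.
  apply/nilpotent_pnilpotent/IHsub.
    rewrite properEneq subsetIl andbT; apply: contraNneq ntX => NXK.
    rewrite -subG1 -Op1 pcore_max ?(pgroupS (char_sub chX)) //.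
    by rewrite /normal (subset_trans (char_sub chX)) //= -NXK subsetIr.
  by rewrite normsI // norms_norm // (char_norm_trans chX).
have ntM : 'O_p^'(K) != 1.
  apply: contra_neq ntK => M1; rewrite -Op1; apply/esym.
  have pK := pnilpotent_pgroup pnK M1.
  by apply/eqP; rewrite eqEsubset pcore_sub pcore_max.
have nilM : nilpotent 'O_p^'(K).
  apply: IHsub; last by rewrite gFnorm_trans.
  rewrite properEneq pcore_sub andbT; apply: contraTneq p_dv => defM.
  by rewrite -p'natE //; have := pcore_pgroup p^' K; rewrite defM.
have [q q_pr q_dv] := exp _ ntM; exists q; have : 'O_q('O_p^'(K)) != 1.
  rewrite -cardG_gt1 (card_Hall (nilpotent_pcore_Hall q nilM)).
  by rewrite p_part_gt1 mem_primes q_pr cardG_gt0.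
apply: contraNneq => Oq1; rewrite -subG1 -Oq1 pcore_max ?pcore_pgroup //.
by rewrite !gFnormal_trans.
Qed.

Local Open Scope ring_scope.

(** * Galois conjugacy of irreducible characters *)

Section GaloisOrbit.

Variables (gT : finGroupType) (X : {group gT}).
Implicit Types i j : Iirr X.

Definition gal_conj i j : bool :=
  [exists s in 'Gal(char_field i / 1), [forall x,
     vf_embed (irr_value_field i) (s (vf_val (irr_value_field i) x)) == 'chi_j x]].

(** Automorphisms of the value field extend to [algC], and endomorphisms of [algC] restrict to it
    because it is normal over Q. Conjugacy can then be handled by [cfAut] alone. *)
Lemma gal_conjP i j :
  reflect (exists nu : {rmorphism algC -> algC}, 'chi_j = cfAut nu 'chi_i) (gal_conj i j).
Proof.
set V := irr_value_field i.
apply: (iffP exists_inP) => [[s _ /forallP sE] | [nu def_j]].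
  have [nu nuE] := extend_algC_subfield_aut (vf_embed V) s.
  exists nu; apply/cfunP=> x; rewrite cfunE -(vf_valE V) -nuE.
  by apply/esym/eqP/sE.
have [nu0 nuE] := restrict_aut_to_normal_num_field (vf_embed V) nu.
pose f : 'AEnd(vf_sort V) := linfun nu0.
have fE a : f a = nu0 a by rewrite lfunE.
have /and3P[_ _ /forall_inP nE] := vf_galois V.
have autf : kAut 1 (char_field i) f.
  by rewrite kAut1E (eqP (nE f _)) ?subvv // inE kAut1E subvf.
have [s gal_s sE] := kAut_to_gal autf; exists s => //.
apply/forallP=> x; rewrite -sE ?seqv_sub_adjoin ?codom_f //.
by rewrite fE nuE vf_valE def_j cfunE.
Qed.

Lemma gal_conj_refl i : gal_conj i i.
Proof. by apply/gal_conjP; exists idfun; apply/cfunP=> x; rewrite cfunE. Qed.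

Lemma gal_conj_eq i j : gal_conj i j -> gal_conj i =1 gal_conj j.
Proof.
case/gal_conjP=> nu def_j k; apply/gal_conjP/gal_conjP=> -[nu' ->].
  exists (nu' \o algC_invaut nu); apply/cfunP=> x.
  by rewrite def_j !cfunE /= algC_autK.
by exists (nu' \o nu); apply/cfunP=> x; rewrite def_j !cfunE.
Qed.

(** The Galois group acts freely on the orbit of the character, since the values generate the field;
    so the sum over the group is a sum over the orbit. *)
Lemma eQ_coefE i x :
  eQ_coef i x = 'chi_i 1%g / #|X|%:R * \sum_(j | gal_conj i j) 'chi_j x.
Proof.
rewrite /eQ_coef; set V := irr_value_field i; congr (_ * _).
have irr_s (s : gal_of (char_field i)) :
    {j : Iirr X | forall x, vf_embed V (s (vf_val V x)) = 'chi_j x}.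
  have [nu nuE] := extend_algC_subfield_aut (vf_embed V) s.
  exists (aut_Iirr nu i) => x'; rewrite aut_IirrE cfunE nuE.
  by rewrite -(vf_valE V).
pose h s := sval (irr_s s).
have hE (s : gal_of (char_field i)) x' : vf_embed V (s (vf_val V x')) = 'chi_(h s) x' := svalP (irr_s s) x'.
have injh : {in 'Gal(char_field i / 1) &, injective h}.
  move=> s t gal_s gal_t eq_st.
  have st_val x' : s (vf_val V x') = t (vf_val V x').
    by apply: (fmorph_inj (vf_embed V)); rewrite !hE eq_st.
  have E_val x' : vf_val V x' \in char_field i by rewrite seqv_sub_adjoin ?codom_f.
  suffices sEfix : (char_field i <= fixedSpace (s * t^-1)%g)%VS.
    apply/eqP; rewrite eq_mulgV1; apply/gal_eqP=> a Ea.
    by rewrite gal_id; apply/fixedSpaceP/(subvP sEfix).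
  apply/Fadjoin_seqP; split; first exact: sub1v.
  move=> _ /codomP[x' ->]; apply/fixedSpaceP.
  by rewrite galM ?E_val // st_val -galM ?E_val // mulgV gal_id.
transitivity (\sum_(s in 'Gal(char_field i / 1)) 'chi_(h s) x).
  by apply: eq_bigr => s _; rewrite hE.
rewrite -(big_imset (fun j => 'chi_j x) injh) /=; apply: eq_bigl => j.
apply/imsetP/exists_inP=> [[s gal_s ->] | [s gal_s /forallP sE]]; exists s => //.
  by apply/forallP=> x'; rewrite hE.
by apply: irr_inj; apply/cfunP=> x'; rewrite -hE -(eqP (sE x')).
Qed.

End GaloisOrbit.

(** * Complex representations of the rational group algebra *)

Section GroupAlgebraRepr.

Variables (gT : finGroupType) (X : {group gT}).
Implicit Types (u v : grpalg rat gT) (g x y : gT).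

Lemma grpalg_sum u : u = \sum_g u g *: ga rat g.
Proof.
apply/ffunP=> x; rewrite sum_ffunE (bigD1 x) //= big1 => [|g /negPf ngx].
  by rewrite !ffunE eqxx addr0 [_ *: _]mulr1.
by rewrite !ffunE eq_sym ngx [_ *: _]mulr0.
Qed.

Lemma grpalg_ofP u : reflect (forall g, g \notin X -> u g = 0) (u \in grpalg_of rat X).
Proof.
apply: (iffP idP) => [/memv_sumP[w wP ->] g notXg | u0].
  rewrite sum_ffunE big1 // => h Xh; have /vlineP[k ->] := wP h Xh.
  rewrite !ffunE (_ : (g == h) = false) ?[_ *: _]mulr0 //.
  by apply: contraNF notXg => /eqP->.
rewrite (grpalg_sum u); apply: rpred_sum => g _.
have [Xg | /u0->] := boolP (g \in X); last by rewrite scale0r rpred0.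
rewrite memvZ //; apply: subvP (memv_line _).
exact: (sumv_sup g).
Qed.

Lemma ga_grpalg_of g : g \in X -> ga rat g \in grpalg_of rat X.
Proof. by move=> Xg; apply/grpalg_ofP=> h; rewrite ffunE; case: eqP => // ->; rewrite Xg. Qed.

Lemma grpalg_of_mul u v :
  u \in grpalg_of rat X -> v \in grpalg_of rat X -> u * v \in grpalg_of rat X.
Proof.
move=> /grpalg_ofP u0 /grpalg_ofP v0; apply/grpalg_ofP=> g notXg.
rewrite ffunE big1 // => y _; have [Xy | /u0->] := boolP (y \in X); last by rewrite mul0r.
by rewrite v0 ?mulr0 // groupMl ?groupV.
Qed.

Section Repr.

Variables (n : nat) (rX : mx_representation algC X n).

(** Coefficients outside [X] are dropped, so products are respected only on [grpalg_of rat X]. *)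
Definition grpalg_mx u : 'M[algC]_n := \sum_(g in X) ratr (u g) *: rX g.

Fact grpalg_mx_zmod_morphism : zmod_morphism grpalg_mx.
Proof.
move=> u v; rewrite /grpalg_mx -sumrB; apply: eq_bigr => g _.
by rewrite !ffunE rmorphB scalerBl.
Qed.
HB.instance Definition _ :=
  GRing.isZmodMorphism.Build (grpalg rat gT) 'M[algC]_n grpalg_mx grpalg_mx_zmod_morphism.

Lemma grpalg_mxZ (k : rat) u : grpalg_mx (k *: u) = ratr k *: grpalg_mx u.
Proof.
rewrite /grpalg_mx scaler_sumr; apply: eq_bigr => g _.
by rewrite !ffunE rmorphM scalerA.
Qed.

Lemma grpalg_mx_ga g : g \in X -> grpalg_mx (ga rat g) = rX g.
Proof.
move=> Xg; rewrite /grpalg_mx (bigD1 g) //= big1 => [|h /andP[_ /negPf nhg]].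
  by rewrite ffunE eqxx rmorph1 scale1r addr0.
by rewrite ffunE nhg rmorph0 scale0r.
Qed.

Lemma grpalg_mxM u v : u \in grpalg_of rat X -> v \in grpalg_of rat X ->
  grpalg_mx (u * v) = grpalg_mx u *m grpalg_mx v.
Proof.
move=> /grpalg_ofP u0 /grpalg_ofP v0.
rewrite {1}(grpalg_sum u) mulr_suml raddf_sum /grpalg_mx mulmx_suml /=.
rewrite (bigID (mem X)) /= addrC big1 ?add0r => [|g /u0->]; last first.
  by rewrite scale0r mul0r raddf0.
apply: eq_bigr => g Xg; rewrite -scalerAl -/(grpalg_mx _) grpalg_mxZ -scalemxAl.
congr (_ *: _); rewrite {1}(grpalg_sum v) mulr_sumr raddf_sum mulmx_sumr.
rewrite (bigID (mem X)) /= addrC big1 ?add0r => [|h /v0->]; last first.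
  by rewrite scale0r mulr0 raddf0.
apply: eq_bigr => h Xh; rewrite -scalerAr gaM grpalg_mxZ.
by rewrite grpalg_mx_ga ?groupM // repr_mxM // scalemxAr.
Qed.

End Repr.

Lemma grpalg_mx_trace (j : Iirr X) u :
  \tr (grpalg_mx 'Chi_j u) = \sum_(g in X) ratr (u g) * 'chi_j g.
Proof.
rewrite /grpalg_mx raddf_sum /=; apply: eq_bigr => g Xg.
by rewrite mxtraceZ -irrRepr cfunE Xg.
Qed.

(** The regular character recovers coefficients: the traces of u x^-1, weighted by the degrees, add
    up to |X| times the coefficient of u at x. *)
Lemma grpalg_mx_eq0 u : u \in grpalg_of rat X ->
  (forall j : Iirr X, grpalg_mx 'Chi_j u = 0) -> u = 0.
Proof.
move=> Xu u0; apply/ffunP=> x; rewrite ffunE.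
have [Xx | notXx] := boolP (x \in X); last by rewrite (grpalg_ofP _ Xu).
have: \sum_j 'chi[X]_j 1%g * \tr (grpalg_mx 'Chi_j (u * ga rat x^-1)) = 0.
  rewrite big1 // => j _; rewrite grpalg_mxM ?ga_grpalg_of ?groupV //.
  by rewrite u0 mul0mx raddf0 mulr0.
under eq_bigr => j _ do rewrite grpalg_mx_trace mulr_sumr.
have regE g : \sum_j 'chi[X]_j 1%g * 'chi_j g = #|X|%:R *+ (g == 1%g).
  rewrite -cfRegE cfReg_sum sum_cfunE.
  by apply: eq_bigr => j _; rewrite cfunE.
rewrite exchange_big (bigD1 1%g) //= [X in _ + X]big1 ?addr0 => [|g /andP[Xg /negPf ntg]].
  under eq_bigr => j _ do rewrite mulrCA.
  rewrite -mulr_sumr regE eqxx mulr1n => /eqP; rewrite mulf_eq0 (negPf (neq0CG X)) orbF.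
  rewrite fmorph_eq0 ffunE (bigD1 x) //= big1 ?addr0 => [|y nyx].
    by rewrite mulg1 ffunE eqxx mulr1 => /eqP.
  rewrite mulg1 ffunE (inj_eq invg_inj) (negPf nyx) mulr0 //.
under eq_bigr => j _ do rewrite mulrCA.
by rewrite -mulr_sumr regE ntg mulr0n mulr0.
Qed.

Lemma grpalg_mx_inj u v : u \in grpalg_of rat X -> v \in grpalg_of rat X ->
  (forall j : Iirr X, grpalg_mx 'Chi_j u = grpalg_mx 'Chi_j v) -> u = v.
Proof.
move=> Xu Xv eq_uv; apply/eqP; rewrite -subr_eq0; apply/eqP/grpalg_mx_eq0.
  by rewrite rpredB.
by move=> j; rewrite raddfB /= eq_uv subrr.
Qed.

End GroupAlgebraRepr.

(** * The idempotents e_Q *)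

Section RationalIdempotentTheory.

Variables (gT : finGroupType) (X : {group gT}).
Implicit Types (i j k : Iirr X).

(** The sum commutes with the representation, so is scalar by Schur's lemma; the first orthogonality
    relation gives its trace. *)
Lemma sum_irr_repr k j :
  \sum_(g in X) 'chi_k g *: 'Chi_j g^-1%g
    = ((k == j)%:R * #|X|%:R / 'chi_j 1%g)%:M.
Proof.
set A := \sum_(g in X) _.
have /is_scalar_mxP[a defA] : is_scalar_mx A.
  apply: (mx_abs_irr_cent_scalar (groupC (socle_irr _))).
  apply/centgmxP=> x Xx; rewrite /A mulmx_suml mulmx_sumr.
  have nXx' : x^-1%g \in 'N(X) by rewrite groupV (subsetP (normG X)).
  rewrite (reindex_inj (conjg_inj x^-1%g)) /=; apply: eq_big => [g | g].
    by rewrite memJ_norm.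
  rewrite memJ_norm // => Xg.
  rewrite cfunJ ?groupV // -scalemxAl -scalemxAr -!repr_mxM ?groupV ?groupJ ?groupV //.
  by rewrite -conjVg conjgE invgK mulgA mulgKV.
have trA : \tr A = (k == j)%:R * #|X|%:R.
  rewrite /A raddf_sum /= -(first_orthogonality_relation k j) mulrAC mulVf ?neq0CG // mul1r.
  by apply: eq_bigr => g Xg; rewrite mxtraceZ -(irrRepr j) cfunE groupV Xg.
rewrite defA; congr (_%:M); rewrite -trA defA mxtrace_scalar -mulr_natr.
by rewrite irr1_degree mulfK // pnatr_eq0 -lt0n irr_degree_gt0.
Qed.

Lemma eQ_grpalg i : eQ i \in grpalg_of rat X.
Proof. by apply: rpred_sum => g Xg; rewrite memvZ // ga_grpalg_of ?groupV. Qed.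

(** Through [grpalg_mx_inj] and [grpalg_mx_eq0], the lemmas [eQ_eq], [eQ_orthogonal] and [eQ_idem]
    become statements about Galois orbits. *)
Lemma grpalg_mx_eQ i j : grpalg_mx 'Chi_j (eQ i) = (gal_conj i j)%:R%:M.
Proof.
rewrite /eQ raddf_sum /=.
transitivity (\sum_(g in X) \sum_(k | gal_conj i k)
    ('chi_i 1%g / #|X|%:R) *: ('chi_k g *: 'Chi_j g^-1%g)).
  apply: eq_bigr => g Xg; rewrite grpalg_mxZ grpalg_mx_ga ?groupV // eQ_coefK eQ_coefE.
  by rewrite mulr_sumr scaler_suml; apply: eq_bigr => k _; rewrite scalerA.
rewrite exchange_big /=.
under eq_bigr => k _ do rewrite -scaler_sumr sum_irr_repr scale_scalar_mx.
have nkj k : k != j -> ('chi_i 1%g / #|X|%:R * ((k == j)%:R * #|X|%:R / 'chi_j 1%g))%:M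
    = 0 :> 'M[algC]_(irr_degree (socle_of_Iirr j)).
  by move/negPf->; rewrite !mul0r mulr0 raddf0.
have [gij | ngij] := boolP (gal_conj i j); last first.
  rewrite big1 => [|k gik]; first by rewrite raddf0.
  by apply: nkj; apply: contraNneq ngij => <-.
rewrite (bigD1 j) //= big1 ?addr0 => [|k /andP[_]]; last exact: nkj.
rewrite eqxx mul1r; congr (_%:M).
have /gal_conjP[nu defj] := gij.
have -> : 'chi_j 1%g = 'chi_i 1%g by rewrite defj cfunE irr1_degree rmorph_nat.
by rewrite mulrA divfK ?neq0CG // divff ?irr1_neq0.
Qed.

Lemma eQ_eq i j : gal_conj i j -> eQ i = eQ j.
Proof.
move=> gij; apply: (grpalg_mx_inj (eQ_grpalg i) (eQ_grpalg j)) => k.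
by rewrite !grpalg_mx_eQ (gal_conj_eq gij).
Qed.

Lemma eQ_orthogonal i j : eQ i != eQ j -> eQ i * eQ j = 0.
Proof.
move=> neq_ij; apply: (@grpalg_mx_eq0 _ X) => [|k]; first by rewrite grpalg_of_mul ?eQ_grpalg.
rewrite grpalg_mxM ?eQ_grpalg // !grpalg_mx_eQ -scalar_mxM.
case gik: (gal_conj i k); last by rewrite mul0r raddf0.
case gjk: (gal_conj j k); last by rewrite mulr0 raddf0.
by rewrite (eQ_eq gik) (eQ_eq gjk) eqxx in neq_ij.
Qed.

Lemma eQ_idem i : eQ i * eQ i = eQ i.
Proof.
apply: (grpalg_mx_inj (grpalg_of_mul (eQ_grpalg i) (eQ_grpalg i)) (eQ_grpalg i)) => k.
rewrite grpalg_mxM ?eQ_grpalg // !grpalg_mx_eQ -scalar_mxM.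
by case: (gal_conj i k); rewrite ?mulr1 ?mulr0.
Qed.

Lemma gal_conj_conjg i j x :
  x \in 'N(X) -> gal_conj (conjg_Iirr i x) (conjg_Iirr j x) = gal_conj i j.
Proof.
move=> nXx; apply/gal_conjP/gal_conjP=> -[nu]; rewrite !conjg_IirrE => def_j; exists nu.
  by apply: (can_inj (cfConjgK x)); rewrite def_j cfAutConjg.
by rewrite def_j cfAutConjg.
Qed.

Lemma ga_conj_eQ i x : x \in 'N(X) -> ga_conj (eQ i) x = eQ (conjg_Iirr i x).
Proof.
move=> nXx; rewrite /ga_conj /eQ mulr_sumr mulr_suml.
rewrite [RHS](reindex_inj (conjg_inj x)) /=; apply: eq_big => [g|g Xg].
  by rewrite memJ_norm.
rewrite -scalerAr -scalerAl !gaM; congr (_ *: ga _ _); last first.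
  by rewrite -conjVg conjgE mulgA.
congr getCrat; rewrite !eQ_coefE conjg_IirrE cfConjg1; congr (_ * _).
rewrite [RHS](reindex_inj (@conjg_Iirr_inj _ X x)) /=; apply: eq_big => j.
  by rewrite gal_conj_conjg.
by move=> _; rewrite conjg_IirrE cfConjgEJ.
Qed.

Lemma eQ_central i x : x \in X -> ga_conj (eQ i) x = eQ i.
Proof.
move=> Xx; rewrite ga_conj_eQ ?(subsetP (normG X)) //.
suffices -> : conjg_Iirr i x = i by [].
by apply: irr_inj; rewrite conjg_IirrE cfConjg_id.
Qed.

End RationalIdempotentTheory.

(** * Links of the chain and Shoda pairs *)

Lemma gss_link_normal (gT : finGroupType) (H K : {group gT}) (i : Iirr H) :
  H <| K -> gss_link H K (eQ i).
Proof.
case/andP=> sHK nHK; split=> //.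
  apply/andP; split.
    by apply/subsetP=> x Hx; rewrite inE (subsetP sHK) // eQ_central ?eqxx.
  by apply: subset_trans nHK; apply/subsetP=> x; rewrite inE => /andP[].
move=> x y Kx Ky; rewrite !ga_conj_eQ ?(subsetP nHK) //.
exact: eQ_orthogonal.
Qed.

Lemma lin_char_cyclic (gT : finGroupType) (H : {group gT}) (lam : 'CF(H)) :
  lam \is a linear_char -> cyclic (H / cfker lam).
Proof.
move=> Ll; suffices defZ : 'Z(lam)%CF = H by have := cfcenter_cyclic lam; rewrite defZ.
rewrite /cfcenter lin_charW //; apply/setP=> h; rewrite inE andb_idr // => Hh.
by rewrite normC_lin_char // lin_char1.
Qed.

(** Mackey's criterion in the form of sums: by Frobenius reciprocity, norm 1 means that the [S y]
    over [G] add up to |H|^2, which those over [H] already do. An element [g] outside [H] violating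
    condition (ii) would contribute the positive number |I g|. *)
Lemma Shoda_pair_Ind_irr (gT : finGroupType) (G H : {group gT}) (lam : 'CF(H)) :
    H \subset G -> lam \is a linear_char -> 'Ind[G] lam \in irr G ->
  Shoda_pair G H (cfker_group lam).
Proof.
move=> sHG Ll irrI; have Cl : lam \is a character := lin_charW Ll.
split=> //=; first exact: cfker_normal.
  exact: lin_char_cyclic.
move=> g Gg sK; apply: contraT => notHg.
pose I (y : gT) := (H :&: H :^ y^-1)%G.
pose S (y : gT) := \sum_(h in H) lam h * (lam (h ^ y)%g)^*.
have SE y : S y = \sum_(h in I y) lam h * (lam (h ^ y)%g)^*.
  rewrite /S (bigID (fun h => (h ^ y)%g \in H)) /= [X in _ + X]big1 ?addr0 => [|h /andP[_ nH]].
    by apply: eq_bigl => h; rewrite inE mem_conjgV.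
  by rewrite (cfun0 _ nH) rmorph0 mulr0.
have lam1 h : h \in H -> lam h * (lam h)^* = 1.
  by move=> Hh; rewrite -normCK normC_lin_char ?expr1n.
have IE y h : h \in I y -> h \in H /\ (h ^ y)%g \in H.
  by rewrite inE mem_conjgV => /andP[].
have S1 y : (forall h, h \in I y -> lam (h ^ y)%g = lam h) -> S y = #|I y|%:R.
  move=> eqI; rewrite SE -sumr_const; apply: eq_bigr => h Ih.
  by rewrite eqI // lam1 //; case: (IE y h Ih).
(* [S y] sums a linear character of [I y], so it is |I y| or 0; in the second case translation by
   [h0] multiplies it by [c], which is not 1. *)
have S_ge0 y : 0 <= S y.
  have [eqI | ] := boolP [forall h in I y, lam (h ^ y)%g == lam h].
    by rewrite S1 ?ler0n // => h Ih; apply/eqP; apply: (forall_inP eqI).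
  rewrite negb_forall_in => /exists_inP[h0 Ih0 neq].
  suffices -> : S y = 0 by [].
  have [Hh0 Hh0y] := IE y h0 Ih0.
  pose c := lam h0 * (lam (h0 ^ y)%g)^*.
  have Sc : S y = c * S y.
    rewrite SE mulr_sumr [LHS](reindex_inj (mulgI h0)) /=; apply: eq_big => [h|h].
      by rewrite groupMl.
    rewrite groupMl // => Ih; have [Hh Hhy] := IE y h Ih.
    by rewrite conjMg (lin_charM Ll Hh0 Hh) (lin_charM Ll Hh0y Hhy) rmorphM /= mulrACA.
  apply/eqP; move/eqP: Sc; rewrite -[X in X == _]mul1r -subr_eq0 -mulrBl mulf_eq0 subr_eq0.
  case/orP=> // /eqP c1; case/eqP: neq.
  by rewrite -[LHS]mul1r c1 /c -mulrA [X in _ * X]mulrC lam1 ?mulr1.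
have HinvK : (#|H|%:R : algC) * #|H|%:R^-1 = 1 by rewrite mulfV ?neq0CG.
have sumS : \sum_(y in G) S y = #|H|%:R * #|H|%:R.
  have := irrWnorm irrI; rewrite -Frobenius_reciprocity cfdotE => sum1.
  rewrite exchange_big /= -[RHS]mulr1 -[X in _ = _ * X]sum1 mulrA -[_ * _ * _^-1]mulrA HinvK mulr1.
  rewrite mulr_sumr; apply: eq_bigr => h Hh; rewrite -mulr_sumr -rmorph_sum /=.
  rewrite cfResE // cfIndE // rmorphM fmorphV rmorph_nat.
  by rewrite [RHS]mulrCA mulVKf ?neq0CG.
have sumH : \sum_(y in H) S y = #|H|%:R * #|H|%:R.
  rewrite [RHS]mulr_natl -sumr_const; apply: eq_bigr => y Hy.
  rewrite S1 => [|h _]; last by rewrite cfunJ.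
  by rewrite /I /= conjGid ?groupV // setIid.
have: \sum_(y in G | y \notin H) S y = 0.
  apply: (addrI (\sum_(y in G | y \in H) S y)); rewrite -bigID addr0 sumS -sumH.
  by apply: eq_bigl => y; rewrite andb_idl // => /(subsetP sHG).
move/eqP; rewrite psumr_eq0 => [/allP/(_ g (mem_index_enum g))| //].
rewrite Gg notHg /= S1 ?pnatr_eq0 ?(gtn_eqF (cardG_gt0 _)) // => h Ih.
have [Hh Hhg] := IE g h Ih.
have Kc : [~ h, g]%g \in cfker lam.
  apply: (subsetP sK); rewrite inE commGC mem_commg ?set11 //=.
  by rewrite groupM ?groupV.
by rewrite -[in LHS](mulKVg h (h ^ g)%g) cfkerMr.
Qed.

(** * Monomiality of nilpotent groups of odd order, compatible with field automorphisms *)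

Section NilpotentMonomial.

(* A nilpotent group of odd order that is not abelian, and has no abelian
   noncyclic normal p-subgroup, would have all its Sylow subgroups cyclic. *)
Lemma nil_odd_abelem_normal (gT : finGroupType) (K : {group gT}) :
    nilpotent K -> odd #|K| -> ~~ abelian K ->
  exists (p : nat) (E : {group gT}), [/\ prime p, E <| K, p.-abelem E, ~~ cyclic E
     & K \subset ('O_p(K) * 'C(E))%g].
Proof.
move=> nilK oddK nabK.
have : ~~ Zgroup K by apply: contra nabK => /nil_Zgroup_cyclic/(_ nilK)/cyclic_abelian.
rewrite negb_forall_in => /exists_inP[V /SylowP[p p_pr sylV] ncV].
have defV : V :=: 'O_p(K) := nilpotent_Hall_pcore nilK sylV.
have pV := pHall_pgroup sylV; have sVK := pHall_sub sylV.
have [X [nsXV abX ncX]] : exists X : {group gT}, [/\ X <| V, abelian X & ~~ cyclic X].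
  have [X XP | cycX] := pickP (fun X : {group gT} => [&& X <| V, abelian X & ~~ cyclic X]).
    by exists X; apply/and3P.
  case: (normal_rank1_structure pV) => [X nsXV abX||/and3P[/eqP p2 _ _]].
  - by have := cycX X; rewrite nsXV abX /= => /negbFE.
  - by rewrite (negPf ncV).
  have ntV : V :!=: 1%g by apply: contraNneq ncV => ->; apply: cyclic1.
  have [_ pdvV _] := pgroup_pdiv pV ntV.
  by have := dvdn_odd (dvdn_trans pdvV (cardSg sVK)) oddK; rewrite p2.
have /dprodP[_ defK cVC tiVC] := nilpotent_pcoreC p nilK.
have sXV := normal_sub nsXV; have sXK := subset_trans sXV sVK.
have cXC : 'O_p^'(K) \subset 'C(X).
  by rewrite (subset_trans cVC) // centS // -defV.
have nsXK : X <| K.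
  rewrite /normal sXK -defK mul_subG ?(cents_norm cXC) //.
  by rewrite -defV normal_norm.
have sEX : 'Ohm_1(X) \subset X := Ohm_sub _ _.
exists p, 'Ohm_1(X)%G; split=> //.
- exact: gFnormal_trans.
- by rewrite Ohm1_abelem // (pgroupS sXV).
- apply: contra ncX; rewrite !abelian_rank1_cyclic ?rank_Ohm1 //.
  exact: abelianS abX.
rewrite -{1}defK mulgS // (subset_trans cXC) // centS //.
Qed.

(** On p-th roots of unity [nu] is a k-th power map, and k^(p^m) = k modulo p by Fermat. So a [nu]
    acting there with p-power order acts trivially. *)
Lemma aut_pth_root (nu : {rmorphism algC -> algC}) p m (z : algC) :
  prime p -> z ^+ p = 1 -> iter (p ^ m) nu z = nu z.
Proof.
move=> p_pr zp1; have [k nuE] : exists k, forall i, nu (z ^+ i) = z ^+ (i * k).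
  have [n prim_z n_dv] := prim_order_exists (prime_gt0 p_pr) zp1.
  have nuz1 : nu z ^+ n = 1 by rewrite -rmorphXn prim_expr_order // rmorph1.
  have [k nuz] := prim_rootP prim_z nuz1.
  by exists k => i; rewrite rmorphXn nuz -exprM mulnC.
have iterE n i : iter n nu (z ^+ i) = z ^+ (i * k ^ n).
  elim: n i => [|n IHn] i; first by rewrite muln1.
  by rewrite iterSr nuE IHn -mulnA expnS.
rewrite -[z in LHS]expr1 -[z in RHS]expr1 iterE nuE !mul1n.
suff: k ^ (p ^ m) = k %[mod p].
  by move=> km; rewrite -(expr_mod _ zp1) km expr_mod.
elim: m => [|m IHm]; first by rewrite expn1.
by rewrite expnSr expnM fermat_little.
Qed.

(** Clifford reduction to the inertia group [T] of a character of [E]. The point is that [nu] fixing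
    ['chi_i] also fixes ['chi_j], so that the stability passes down to [s]. *)
Theorem nil_odd_monomial (gT : finGroupType) (K : {group gT}) (i : Iirr K) :
    nilpotent K -> odd #|K| ->
  exists (L : {group gT}) (l : Iirr L),
    [/\ L \subset K, 'chi_l \is a linear_char, 'chi_i = 'Ind[K] 'chi_l
      & forall nu : {rmorphism algC -> algC},
          cfAut nu 'chi_i = 'chi_i -> cfAut nu 'chi_l = 'chi_l].
Proof.
have [n] := ubnP #|K|; elim: n gT K i => // n IHn gT K i; rewrite ltnS => leKn nilK oddK.
have [ntN | fK] := boolP (cfker 'chi_i != 1%g).
  pose N := cfker_group 'chi_i.
  have nsNK : N <| K := cfker_normal _.
  have [|||Lb [lb [sLK lin_lb]]] := IHn _ (K / N)%G (quo_Iirr N i).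
  - by apply: leq_trans leKn; rewrite ltn_quotient ?cfker_sub.
  - exact: quotient_nil.
  - by rewrite (dvdn_odd (dvdn_quotient _ _)).
  rewrite quo_IirrE //.
  have [L defLb sNL sLK'] := inv_quotientS nsNK sLK.
  have {}defLb : Lb = (L / N)%G by apply: group_inj.
  rewrite {}defLb in lb sLK lin_lb * => defi nuE.
  have nsNL : N <| L := normalS sNL sLK' nsNK.
  exists L, (mod_Iirr lb); rewrite mod_IirrE //; split=> //.
  - exact: cfMod_lin_char.
  - rewrite -(cfQuoK nsNK (subxx _)) defi.
    by apply/esym/cfIndMorph; rewrite ?ker_coset ?normal_norm.
  move=> nu nui; rewrite cfAutMod nuE //.
  by rewrite cfAutQuo nui.
have [abK | nabK] := boolP (abelian K).
  exists K, i; split=> //; first exact/char_abelianP.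
  by rewrite cfInd_id.
have [p [E [p_pr nsEK abE ncE defK]]] := nil_odd_abelem_normal nilK oddK nabK.
have [j jE] := constt_cfRes_irr E i.
have sEK := normal_sub nsEK.
have lin_j : 'chi_j \is a linear_char by apply/char_abelianP/abelem_abelian/abE.
pose T := 'I_K['chi_j]%G.
have [irrA injA IndA] : [/\ {in irr_constt ('Ind[T] 'chi_j), forall s, 'Ind[K] 'chi_s \in irr K},
    {in irr_constt ('Ind[T] 'chi_j) &, injective (Ind_Iirr K)}
    & Ind_Iirr K @: irr_constt ('Ind[T] 'chi_j) =i irr_constt ('Ind[K] 'chi_j)].
  by case: (constt_Inertia_bijection j nsEK).
have Clif := Clifford_Res_sum_cfclass nsEK jE.
(* If ['chi_j] were invariant, its kernel would lie in that of the faithful ['chi_i]; a faithful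
   linear character would make [E] cyclic. *)
have prT : T \proper K.
  rewrite properE subsetIl; apply: contra ncE; rewrite subsetI subxx /= => sKT.
  suffices kj1 : cfker 'chi_j = 1%g.
    have := lin_char_cyclic lin_j; rewrite kj1.
    by rewrite -(isog_cyclic (quotient1_isog E)).
  apply/trivgP; rewrite negbK in fK; rewrite -(eqP fK).
  apply/subsetP=> x kjx; rewrite cfkerEirr inE.
  have Ex := subsetP (cfker_sub _) x kjx; have jx := cfker1 kjx.
  have := Clif; rewrite cfclass_invariant // big_seq1 => Clif1.
  rewrite -(cfResE _ sEK Ex) -[X in _ == X](cfResE _ sEK (group1 E)).
  by rewrite Clif1 !cfunE jx.
have : i \in Ind_Iirr K @: irr_constt ('Ind[T] 'chi_j) by rewrite IndA constt_Ind_Res.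
case/imsetP=> s sA def_i.
have Ind_s : 'Ind[K] 'chi_s = 'chi_i by rewrite def_i cfIirrE ?irrA.
have [|||L [l [sLT lin_l def_s nuE]]] := IHn _ T s.
- exact: leq_trans (proper_card prT) leKn.
- exact: nilpotentS (proper_sub prT) nilK.
- exact: oddSg (proper_sub prT) oddK.
exists L, l; split=> //; first exact: subset_trans sLT (proper_sub prT).
  by rewrite -Ind_s def_s cfIndInd ?(proper_sub prT).
move=> nu nui; apply: nuE; have nuj : cfAut nu 'chi_j = 'chi_j.
  have : cfAut nu 'chi_j \in ('chi_j ^: K)%CF.
    apply: contraT => notcl; move: (jE).
    rewrite irr_consttE -(fmorph_eq0 nu) -(cfdot_aut_irr nu) cfAutRes nui Clif.
    rewrite cfdotZl cfdot_suml big_seq big1 ?mulr0 ?eqxx // => _ /cfclassP[y Ky ->].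
    rewrite -conjg_IirrE -aut_IirrE cfdot_irr (_ : (_ == _) = false) //.
    apply: contraNF notcl => /eqP eqy; apply/cfclassP; exists y => //.
    by rewrite -aut_IirrE -eqy conjg_IirrE.
  case/cfclassP=> g Kg nujg.
  (* The factor [b] centralises [E], so [nu] acts on ['chi_j] as the p-element [a], and its iterate
     of order p^m fixes ['chi_j]; by [aut_pth_root] that iterate agrees with [nu] on the values. *)
  have /mulsgP[a b Oa Cb def_g] := subsetP defK g Kg.
  have Ka : a \in K := subsetP (pcore_sub _ _) a Oa.
  have Kb : b \in K by rewrite -(groupMl _ Ka) -def_g.
  have {nujg}nuja : cfAut nu 'chi_j = ('chi_j ^ a)%CF.
    rewrite nujg def_g (cfConjgM _ nsEK) //.
    by rewrite inertiaJ // (subsetP (cent_sub_inertia _)).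
  have iterJ n' : ('chi_j ^ (a ^+ n')%g)%CF = iter n' (cfAut nu) 'chi_j.
    elim: n' => [|n' IHn']; first by rewrite expg0 cfConjgJ1.
    rewrite expgSr (cfConjgM _ nsEK) ?groupX // IHn' iterSr nuja.
    by elim: n' {IHn'} => //= n' <-; rewrite cfAutConjg.
  have [m oa] := p_natP (mem_p_elt (pcore_pgroup p K) Oa).
  have iter1 : iter (p ^ m) (cfAut nu) 'chi_j = 'chi_j.
    by rewrite -iterJ -oa expg_order cfConjgJ1.
  apply/cfun_inP=> x Ex; rewrite cfunE -(@aut_pth_root nu p m) //; last first.
    rewrite -lin_charX //; have [_ /(_ x Ex) ->] := abelemP p_pr abE.
    by rewrite lin_char1.
  rewrite -[in RHS]iter1; elim: (p ^ m)%N => //= k ->.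
  by rewrite cfunE.
(* Both [s] and its image under [nu] lie over ['chi_j] and induce ['chi_i], so the Clifford
   correspondence identifies them. *)
rewrite -aut_IirrE; congr 'chi_(_); apply: injA => //.
  rewrite irr_consttE aut_IirrE -nuj -cfAutInd cfdot_aut_irr fmorph_eq0.
  by rewrite -irr_consttE.
by rewrite /Ind_Iirr aut_IirrE -cfAutInd Ind_s nui.
Qed.

End NilpotentMonomial.

Lemma subnormal_gen_strong_Shoda (gT : finGroupType) (G H : {group gT}) (lam : 'CF(H)) :
    H <|<| G -> lam \is a linear_char -> 'Ind[G] lam \in irr G ->
  gen_strong_Shoda_pair G H (cfker_group lam).
Proof.
move=> snHG Ll irrI; split; first exact: Shoda_pair_Ind_irr (subnormal_sub snHG) Ll irrI.
move=> l _ _; have /subnormalP[s nHs lastG] := snHG.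
exists (size s), (nth H (H :: s)); split=> //.
  by rewrite -last_nth; apply: group_inj; rewrite lastG.
move=> k lt_k; apply: gss_link_normal.
exact: (pathP H nHs k lt_k).
Qed.

(** * Frobenius groups of odd order with cyclic complement *)

Section FrobeniusMonomial.

Variables (gT : finGroupType) (G K H : {group gT}).
Hypotheses (frobG : [Frobenius G = K ><| H]) (cycH : cyclic H) (oddG : odd #|G|).

Let defG : K ><| H = G. Proof. by have [] := Frobenius_context frobG. Qed.
Let nsKG : K <| G. Proof. by have [] := sdprod_context defG. Qed.

Lemma Frobenius_cyclic_ker_nil : nilpotent K.
Proof.
have [_ ntK ntH _ _] := Frobenius_context frobG.
have [_ _ _ nKH _] := sdprod_context defG.
apply: (@odd_semiregular_nil _ K H) => //.
- exact: oddSg (normal_sub nsKG) oddG.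
- exact: Frobenius_reg_ker frobG.
exact: abelian_sol (cyclic_abelian cycH).
Qed.

Lemma Frobenius_cyclic_lin (i : Iirr G) : K \subset cfker 'chi_i -> 'chi_i \is a linear_char.
Proof.
move=> sKi; rewrite -(cfQuoK nsKG sKi) cfMod_lin_char //.
rewrite -quo_IirrE //; apply/char_abelianP.
rewrite -(isog_abelian (sdprod_isog defG)) //.
exact: cyclic_abelian.
Qed.

Lemma Frobenius_cyclic_monomial (i : Iirr G) :
    ~~ (K \subset cfker 'chi_i) ->
  exists (k : Iirr K) (L : {group gT}) (l : Iirr L),
    [/\ k != 0, 'chi_i = 'Ind[G] 'chi_k, L \subset K,
        'chi_l \is a linear_char & 'chi_k = 'Ind[K] 'chi_l /\
        forall nu : {rmorphism algC -> algC},
          cfAut nu 'chi_k = 'chi_k -> cfAut nu 'chi_l = 'chi_l].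
Proof.
case/(Frobenius_Ind_irrP (FrobeniusWker frobG)) => k ntk def_i.
have oddK : odd #|K| := oddSg (normal_sub nsKG) oddG.
have [L [l [sLK lin_l def_k nuE]]] := nil_odd_monomial k Frobenius_cyclic_ker_nil oddK.
by exists k, L, l.
Qed.

Lemma Frobenius_cyclic_gsm : gen_strongly_monomial G.
Proof.
move=> i; have [sKi | nsKi] := boolP (K \subset cfker 'chi_i).
  have lin_i := Frobenius_cyclic_lin sKi.
  exists G, (cfker_group 'chi_i), i; split; rewrite ?cfInd_id //.
  apply: subnormal_gen_strong_Shoda => //; first exact: subnormal_refl.
  by rewrite cfInd_id mem_irr.
have [k [L [l [_ def_i sLK lin_l [def_k _]]]]] := Frobenius_cyclic_monomial nsKi.
have {}def_i : 'chi_i = 'Ind[G] 'chi_l.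
  by rewrite def_i def_k cfIndInd ?(normal_sub nsKG).
exists L, (cfker_group 'chi_l), l; split=> //.
apply: subnormal_gen_strong_Shoda => //; last by rewrite -def_i mem_irr.
apply: subnormal_trans (normal_subnormal nsKG).
exact: nilpotent_subnormal Frobenius_cyclic_ker_nil sLK.
Qed.

End FrobeniusMonomial.

(** * Division idempotents and matrix units in simple algebras *)

Section SimpleAlgebra.

Variables (F : fieldType) (S : falgType F).
Implicit Types (I J : {vspace S}) (x y z e f : S).

Definition simple_falg := forall I : {vspace S},
  (fullv * I <= I)%VS -> (I * fullv <= I)%VS -> I = 0%VS \/ I = fullv.

Definition right_ideal I := (I * fullv <= I)%VS.

Lemma right_idealP I :
  reflect (forall x s, x \in I -> x * s \in I) (right_ideal I).
Proof.
apply: (iffP prodvP) => [rI x s Ix | rI x s Ix _]; last exact: rI.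
by apply: rI; rewrite ?memvf.
Qed.

Lemma min_right_ideal : exists I, [/\ right_ideal I, I != 0%VS &
  forall J, right_ideal J -> (J <= I)%VS -> J != 0%VS -> J = I].
Proof.
have [n] := ubnP (\dim {:S}); have rS : right_ideal fullv by apply: subvf.
have nzS : (fullv : {vspace S}) != 0%VS by apply: contraTneq (memvf (1 : S)) => ->; rewrite memv0 oner_eq0.
elim: n (fullv : {vspace S}) rS nzS => // n IHn I rI nzI; rewrite ltnS => leIn.
have [[J [rJ sJI nzJ neJI]] | noJ] :=
  classic (exists J, [/\ right_ideal J, (J <= I)%VS, J != 0%VS & J != I]).
  apply: (IHn J) => //; apply: leq_trans leIn.
  by rewrite ltn_neqAle dimv_leqif_eq // neJI dimvS.
exists I; split=> // J rJ sJI nzJ; apply/eqP; apply: contraT => neJI.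
by case: noJ; exists J.
Qed.

Hypothesis simpleS : simple_falg.

(** If x S z = 0, then x annihilates the ideal S z S, which is all of S by simplicity, and so x =
    0. *)
Lemma simple_prime x z : x != 0 -> z != 0 -> exists s, x * s * z != 0.
Proof.
move=> nzx nzz; have [//|no] := classic (exists s, x * s * z != 0).
have xsz s : x * s * z = 0.
  by apply/eqP; apply: contraT => nz; case: no; exists s.
pose J := (fullv * <[z]> * fullv)%VS.
have Jz : z \in J by rewrite -[z]mul1r -[1 * z]mulr1 !memv_mul ?memv_line ?memvf.
have [||J0 | JS] := simpleS (I := J).
- by rewrite /J !prodvA prodvSl // prodvSl // subvf.
- by rewrite /J -prodvA prodvSr // subvf.
- by move: Jz; rewrite J0 memv0 (negPf nzz).
have sJ : (J <= lker (amull x))%VS.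
  apply/prodvP=> u v uJ _; suff: (fullv * <[z]> <= lker (amull x))%VS.
    by move/subvP/(_ u uJ); rewrite !memv_ker !lfunE /= mulrA => /eqP->; rewrite mul0r.
  apply/prodvP=> s w _ /vlineP[k ->]; rewrite memv_ker lfunE /= -scalerAr -scalerAr.
  by rewrite mulrA xsz scaler0.
have := subvP sJ 1; rewrite JS memvf memv_ker lfunE /= mulr1 => /(_ isT).
by rewrite (negPf nzx).
Qed.

(** Brauer's lemma: for [x] in a minimal right ideal [I] with x I nonzero, left multiplication by
    [x] is bijective on [I], and the solution [e] of x e = x is idempotent. Minimality also gives
    right inverses in eSe, which suffices. *)
Lemma division_idempotent : exists e, [/\ e != 0, e * e = e &
  forall z, e * z * e = z -> z != 0 -> exists w, [/\ e * w * e = w, w * z = e & z * w = e]].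
Proof.
have [I [rI nzI minI]] := min_right_ideal.
have rIP := right_idealP _ rI.
have vpI : vpick I != 0 by rewrite vpick0.
set v := vpick I in vpI; have Iv : v \in I := memv_pick I.
have [s nz_vsv] := simple_prime vpI vpI.
set x := v * s in nz_vsv; have Ix : x \in I := rIP v s Iv.
pose xI := (amull x @: I)%VS.
have xIP u : reflect (exists2 w, w \in I & u = x * w) (u \in xI).
  by apply: (iffP memv_imgP) => -[w Iw ->]; exists w => //; rewrite lfunE.
have xI_I : xI = I.
  apply: minI.
  - apply/right_idealP=> _ t /xIP[w Iw ->]; apply/xIP.
    by exists (w * t); rewrite ?mulrA // rIP.
  - by apply/subvP=> _ /xIP[w Iw ->]; rewrite rIP.
  apply: contraNneq nz_vsv => xI0; rewrite -memv0 -xI0.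
  by apply/xIP; exists v.
have /xIP[e Ie xe] : x \in xI by rewrite xI_I.
have nzx : x != 0 by apply: contraNneq nz_vsv => ->; rewrite mul0r.
have nze : e != 0 by apply: contraNneq nzx => e0; rewrite xe e0 mulr0.
have ker0 w : w \in I -> x * w = 0 -> w = 0.
  move=> Iw xw0; apply/eqP; apply: contraT => nzw.
  have nzZ : (lker (amull x) :&: I)%VS != 0%VS.
    apply: contraNneq nzw => Z0; rewrite -memv0 -Z0 memv_cap Iw memv_ker lfunE /=.
    by rewrite xw0 eqxx.
  have ZI : (lker (amull x) :&: I)%VS = I.
    apply: minI; rewrite ?capvSr //; apply/right_idealP=> u t.
    rewrite !memv_cap !memv_ker !lfunE /= => /andP[/eqP xu Iu].
    by rewrite mulrA xu mul0r eqxx rIP.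
  by move: Ie; rewrite -ZI memv_cap memv_ker lfunE /= -xe (negPf nzx).
have ee : e * e = e.
  apply/eqP; rewrite -subr_eq0; apply/eqP/ker0; first by rewrite rpredB ?rIP.
  by rewrite mulrBr mulrA -xe -xe subrr.
exists e; split=> //.
have rinv z : e * z * e = z -> z != 0 -> exists2 w, e * w * e = w & z * w = e.
  move=> eze nzz; have ez : e * z = z by rewrite -eze !mulrA ee.
  have ze : z * e = z by rewrite -eze -!mulrA ee.
  have Iz : z \in I by rewrite -ez rIP.
  have zS : (amull z @: fullv)%VS = I.
    apply: minI.
    - apply/right_idealP=> _ t /memv_imgP[w _ ->]; rewrite lfunE /= -mulrA.
      by apply/memv_imgP; exists (w * t); rewrite ?memvf ?lfunE.
    - by apply/subvP=> _ /memv_imgP[w _ ->]; rewrite lfunE /= rIP.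
    apply: contraNneq nzz => z0; rewrite -memv0 -z0; apply/memv_imgP.
    by exists 1; rewrite ?memvf ?lfunE //= mulr1.
  move: Ie; rewrite -zS => /memv_imgP[t _]; rewrite lfunE /= => et.
  exists (e * t * e); first by rewrite !mulrA ee -!mulrA ee.
  by rewrite !mulrA ze -et ee.
move=> z eze nzz; have [w ewe zw] := rinv z eze nzz.
have nzw : w != 0 by apply: contraNneq nze => w0; rewrite -zw w0 mulr0.
have [w' ewe' ww'] := rinv w ewe nzw.
exists w; split=> //; suff <- : w' = z by [].
have ew' : e * w' = w' by rewrite -ewe' !mulrA ee.
by rewrite -ew' -zw -mulrA ww' -eze -!mulrA ee.
Qed.

Section MatrixUnits.

Variable e : S.
Hypotheses (nze : e != 0) (ee : e * e = e).
Hypothesis divE : forall z, e * z * e = z -> z != 0 ->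
  exists w, [/\ e * w * e = w, w * z = e & z * w = e].

(** The [x i] and [y i] identify f S with a direct sum of m copies of e S. One copy is split off at
    a time, f - x y generating a smaller right ideal. *)
Lemma matrix_units f : f * f = f ->
  exists m (x y : nat -> S),
    [/\ forall i, (i < m)%N -> [/\ f * x i = x i, x i * e = x i, e * y i = y i & y i * f = y i],
        forall i j, (i < m)%N -> (j < m)%N -> y i * x j = (if i == j then e else 0)
      & \sum_(i < m) x i * y i = f].
Proof.
have [n] := ubnP (\dim (amull f @: fullv)); elim: n f => // n IHn f; rewrite ltnS => lefn ff.
have [f0 | nzf] := eqVneq f 0.
  by exists 0%N, (fun=> 0), (fun=> 0); split; rewrite ?big_ord0.
have [x [fx xe nzx]] : exists x, [/\ f * x = x, x * e = x & x != 0].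
  have [a nzx] := simple_prime nzf nze; exists (f * a * e).
  by rewrite !mulrA ff -[_ * e * e]mulrA ee.
have [s nz_esx] := simple_prime nze nzx.
have [|d [ede dz _]] := divE _ nz_esx; first by rewrite !mulrA ee -[_ * x * e]mulrA xe.
(* [d] inverts e s x in the division algebra eSe, which makes d e s f a left inverse of [x]. *)
have [y [yx ey yf]] : exists y, [/\ y * x = e, e * y = y & y * f = y].
  exists (d * e * s * f); split; last by rewrite -mulrA ff.
    by rewrite -[LHS]mulrA fx -[RHS]dz !mulrA.
  by rewrite -ede !mulrA ee.
pose f' := f - x * y.
have f'x : f' * x = 0 by rewrite mulrBl fx -mulrA yx xe subrr.
have yf' : y * f' = 0 by rewrite mulrBr yf mulrA yx ey subrr.
have ff' : f * f' = f' by rewrite mulrBr ff mulrA fx.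
have f'f : f' * f = f' by rewrite mulrBl ff -mulrA yf.
have f'f' : f' * f' = f' by rewrite {2}/f' mulrBr f'f mulrA f'x mul0r subr0.
have [|m [X [Y [XY YX sumXY]]]] := IHn f' _ f'f'.
  apply: leq_trans lefn; rewrite ltn_neqAle dimvS ?andbT; last first.
    apply/subvP=> _ /memv_imgP[w _ ->]; rewrite lfunE /= -ff' -mulrA.
    by apply/memv_imgP; exists (f' * w); rewrite ?memvf ?lfunE.
  rewrite dimv_leqif_eq; last first.
    apply/subvP=> _ /memv_imgP[w _ ->]; rewrite lfunE /= -ff' -mulrA.
    by apply/memv_imgP; exists (f' * w); rewrite ?memvf ?lfunE.
  apply: contraNneq nzx => eqf; have: x \in (amull f' @: fullv)%VS.
    by rewrite eqf; apply/memv_imgP; exists x; rewrite ?memvf ?lfunE.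
  case/memv_imgP=> w _; rewrite lfunE /= => xw.
  by rewrite -f'x xw mulrA f'f'.
exists m.+1, (fun i => if i is k.+1 then X k else x), (fun i => if i is k.+1 then Y k else y).
have yX k : (k < m)%N -> y * X k = 0.
  by move=> lt_km; have [<- _ _ _] := XY k lt_km; rewrite mulrA yf' mul0r.
have Yx k : (k < m)%N -> Y k * x = 0.
  by move=> lt_km; have [_ _ _ <-] := XY k lt_km; rewrite -mulrA f'x mulr0.
split.
- case=> [|k] // lt_km; have [f'X Xe eY Yf'] := XY k lt_km; split=> //.
    by rewrite -f'X mulrA ff'.
  by rewrite -Yf' -mulrA f'f.
- by case=> [|k] [|l] ltk ltl; rewrite ?yx ?yX ?Yx ?YX.
by rewrite big_ord_recl /= sumXY addrC subrK.
Qed.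

End MatrixUnits.

End SimpleAlgebra.

(** * The corner eSe, and S as a matrix algebra over it *)

Section Corner.

Variables (F : fieldType) (S : falgType F) (e : S).
Hypotheses (nze : e != 0) (ee : e * e = e).

Definition corner_space : {vspace S} := (amull e @: (amulr e @: fullv))%VS.

Lemma mem_corner z : (z \in corner_space) = (e * z * e == z).
Proof.
apply/memv_imgP/eqP=> [[w /memv_imgP[v _ ->] ->] | eze].
  by rewrite !lfunE /= !mulrA ee -!mulrA ee.
exists (z * e); last by rewrite lfunE /= mulrA eze.
by apply/memv_imgP; exists z; rewrite ?memvf ?lfunE.
Qed.

Lemma corner_mull z : z \in corner_space -> e * z = z.
Proof. by rewrite mem_corner => /eqP <-; rewrite !mulrA ee. Qed.

Lemma corner_mulr z : z \in corner_space -> z * e = z.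
Proof. by rewrite mem_corner => /eqP <-; rewrite -!mulrA ee. Qed.

Fact corner_is_aspace : is_aspace corner_space.
Proof.
apply/andP; split.
  apply/has_algidP; exists e; split=> //; first by rewrite mem_corner !ee.
  by move=> z Ez; rewrite corner_mull ?corner_mulr.
apply/prodvP=> u v Eu Ev.
by rewrite mem_corner mulrA (corner_mull Eu) -mulrA (corner_mulr Ev).
Qed.
Definition corner : {aspace S} := ASpace corner_is_aspace.

Lemma algid_corner : algid corner = e.
Proof.
have Ee : e \in corner by rewrite mem_corner !ee.
by rewrite -[LHS](corner_mull (memv_algid corner)) (algidr Ee).
Qed.

Hypothesis divE : forall z, e * z * e = z -> z != 0 ->
  exists w, [/\ e * w * e = w, w * z = e & z * w = e].

Lemma corner_division : division_ring (subvs_of corner).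
Proof.
move=> z nzz; apply/unitrP.
have Ez : e * vsval z * e = vsval z by apply/eqP; rewrite -mem_corner; apply: subvsP.
have [|w [ewe wz zw]] := divE Ez; first by rewrite (inj_eq val_inj z 0) .
have Ew : w \in corner by rewrite mem_corner ewe.
exists (Subvs Ew); split; apply: val_inj; rewrite /= ?wz ?zw algid_corner //.
Qed.

Variables (m : nat) (x y : nat -> S).
Hypotheses (xyP : forall i, (i < m.+1)%N -> [/\ x i * e = x i & e * y i = y i])
  (yxE : forall i j, (i < m.+1)%N -> (j < m.+1)%N -> y i * x j = (if i == j then e else 0))
  (sum_xy : \sum_(i < m.+1) x i * y i = 1).

Definition corner_mx (s : S) : 'M[subvs_of corner]_m.+1 :=
  \matrix_(i, j) vsproj corner (y i * s * x j).

Let corner_mxE s i j : vsval (corner_mx s i j) = y i * s * x j.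
Proof.
rewrite mxE vsprojK // -/(corner).
have [_ ey] := xyP (ltn_ord i); have [xe _] := xyP (ltn_ord j).
by rewrite mem_corner !mulrA ey -!mulrA xe.
Qed.

Fact corner_mx_zmod_morphism : zmod_morphism corner_mx.
Proof.
move=> s t; apply/matrixP=> i j; have subE (A B : 'M[subvs_of corner]_m.+1) :
    (A - B) i j = A i j - B i j by rewrite !mxE.
by apply: val_inj; rewrite subE raddfB /= !corner_mxE mulrBr mulrBl.
Qed.

Fact corner_mx_monoid_morphism : monoid_morphism corner_mx.
Proof.
split=> [|s t]; apply/matrixP=> i j; apply: val_inj; rewrite /= corner_mxE.
  rewrite mulr1 yxE // mxE -val_eqE /=; case: eqP => _; last by rewrite raddf0.
  by rewrite /= algid_corner.
rewrite mxE raddf_sum -[s in LHS]mulr1 -sum_xy.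
rewrite mulr_sumr mulr_suml mulr_sumr mulr_suml; apply: eq_bigr => k _.
by rewrite /= !corner_mxE !mulrA.
Qed.

HB.instance Definition _ := GRing.isZmodMorphism.Build S 'M[subvs_of corner]_m.+1
  corner_mx corner_mx_zmod_morphism.
HB.instance Definition _ := GRing.isMonoidMorphism.Build S 'M[subvs_of corner]_m.+1
  corner_mx corner_mx_monoid_morphism.

Lemma corner_mx_bij : bijective corner_mx.
Proof.
exists (fun M : 'M[subvs_of corner]_m.+1 =>
  \sum_(i < m.+1) \sum_(j < m.+1) x i * vsval (M i j) * y j) => [s | M].
    apply: (etrans (y := (\sum_(i < m.+1) x i * y i) * s * (\sum_(i < m.+1) x i * y i))).
    rewrite mulr_suml mulr_suml; apply: eq_bigr => i _.
    by rewrite mulr_sumr; apply: eq_bigr => j _; rewrite corner_mxE !mulrA.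
  by rewrite sum_xy mul1r mulr1.
apply/matrixP=> i j; apply: val_inj; rewrite /= corner_mxE.
rewrite mulr_sumr mulr_suml (bigD1 i) //= [X in _ + X]big1 ?addr0 => [|k /negPf nki].
  rewrite mulr_sumr mulr_suml (bigD1 j) //= [X in _ + X]big1 ?addr0 => [|k /negPf nkj].
    rewrite !mulrA yxE // eqxx -!mulrA yxE // eqxx.
    by rewrite corner_mulr ?corner_mull ?subvsP.
  by rewrite -!mulrA yxE // val_eqE nkj !mulr0.
rewrite mulr_sumr mulr_suml big1 // => l _.
by rewrite !mulrA yxE // val_eqE eq_sym nki !mul0r.
Qed.

Lemma corner_ring_iso : ring_iso S 'M[subvs_of corner]_m.+1.
Proof. by exists corner_mx; apply: corner_mx_bij. Qed.

End Corner.

(** * Traces and ranks of idempotents of a simple algebra in a complex representation *)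

Lemma mxtrace_idem (F : fieldType) n (P : 'M[F]_n) : P *m P = P -> \tr P = (\rank P)%:R.
Proof.
move=> PP; rewrite -{1}(mulmx_base P) mxtrace_mulC.
(* In a rank factorisation of an idempotent, the factors multiply to the identity in the reverse
   order. *)
suffices -> : row_base P *m col_base P = 1%:M by rewrite mxtrace1.
apply: (row_free_inj (row_base_free P)); rewrite /= mul1mx.
apply: (row_full_inj (col_base_full P)).
by rewrite -mulmxA mulmxA !mulmx_base.
Qed.

Section TraceArgument.

Variables (S : falgType rat) (n : nat) (rho : {additive S -> 'M[algC]_n}).
Hypotheses (rhoM : forall u v, rho (u * v) = rho u *m rho v) (rho1 : rho 1 = 1%:M).

Lemma rho_idem f : f * f = f -> \tr (rho f) = (\rank (rho f))%:R.
Proof. by move=> ff; apply: mxtrace_idem; rewrite -rhoM ff. Qed.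

Lemma matrix2_even (R : nzRingType) : ring_iso S 'M[R]_2 -> ~~ odd n.
Proof.
case=> f [g fK gK]; have injf := can_inj fK.
pose E i j : S := g (delta_mx i j).
have fE i j : f (E i j) = delta_mx i j by rewrite gK.
pose i0 := 0 : 'I_2; pose i1 := 1 : 'I_2.
have EE i j k : E i j * E j k = E i k.
  by apply: injf; rewrite rmorphM !fE; apply: mul_delta_mx.
have E1 : E i0 i0 + E i1 i1 = 1.
  apply: injf; rewrite rmorphD rmorph1 !fE; apply/matrixP=> i j.
  by case: i => [[|[|//]] i] /=; case: j => [[|[|//]] j]; rewrite !mxE /= ?addr0 ?add0r.
have eq_tr : \tr (rho (E i0 i0)) = \tr (rho (E i1 i1)).
  by rewrite -(EE i0 i1 i0) -(EE i1 i0 i1) !rhoM mxtrace_mulC.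
have : (n%:R : algC) = (\rank (rho (E i0 i0))).*2%:R.
  by rewrite -mxtrace1 -rho1 -E1 raddfD mxtraceD -eq_tr rho_idem ?EE // -addnn natrD.
by move/eqP; rewrite eqC_nat => /eqP->; rewrite odd_double.
Qed.

Hypotheses (simpleS : simple_falg S) (n_gt0 : (0 < n)%N).

(** A nonzero [u] in the kernel can be multiplied into the division algebra eSe without vanishing,
    so the kernel contains [e], and then all the x_i y_i that add up to 1. *)
Lemma simple_falg_inj : injective rho.
Proof.
suffices ker0 u : rho u = 0 -> u = 0.
  by move=> u v eq_uv; apply/eqP; rewrite -subr_eq0 (ker0 (u - v)) // raddfB eq_uv subrr.
move=> ru0; apply/eqP; apply: contraT => nzu.
have [e [nze ee divE]] := division_idempotent simpleS.
have [s nz_esu] := simple_prime simpleS nze nzu.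
have [t nz_et] := simple_prime simpleS nz_esu nze.
have [|w [_ we _]] := divE _ _ nz_et; first by rewrite !mulrA ee -[_ * e * e]mulrA ee.
have re0 : rho e = 0 by rewrite -we !rhoM ru0 mulmx0 !mul0mx mulmx0.
have [m [x [y [xyP _ sum_xy]]]] := matrix_units simpleS nze ee divE (mulr1 1).
have : \tr (rho 1) = 0.
  rewrite -sum_xy raddf_sum raddf_sum big1 // => i _.
  by have [_ <- _ _] := xyP i (ltn_ord i); rewrite /= !rhoM re0 mulmx0 mul0mx mxtrace0.
by rewrite rho1 mxtrace1 => /eqP; rewrite pnatr_eq0 (gtn_eqF n_gt0).
Qed.

Lemma simple_falg_iso (f1 f2 : S) (a b : nat) :
    f1 * f1 = f1 -> f2 * f2 = f2 -> \tr (rho f1) = a%:R -> \tr (rho f2) = b%:R ->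
    coprime a b ->
  exists m (D : falgType rat),
    [/\ division_ring D, commutative (@GRing.mul D) & ring_iso S 'M[D]_m.+1].
Proof.
move=> idf1 idf2 tr1 tr2 cop_ab.
have [e [nze ee divE]] := division_idempotent simpleS.
have rank_dvd f c : f * f = f -> \tr (rho f) = c%:R -> (\rank (rho e) %| c)%N.
  move=> ff; have [m [x [y [_ yx <-]]]] := matrix_units simpleS nze ee divE ff.
  have -> : \tr (rho (\sum_(i < m) x i * y i)) = (m * \rank (rho e))%:R.
    rewrite raddf_sum raddf_sum natrM mulr_natl -[m in RHS]card_ord -sumr_const.
    apply: eq_bigr => i _; rewrite /= rhoM mxtrace_mulC -rhoM yx // eqxx.
    exact: rho_idem.
  by move/eqP; rewrite eqC_nat => /eqP <-; rewrite dvdn_mull.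
have rank1 : \rank (rho e) = 1%N.
  by apply/eqP; rewrite -dvdn1 -(eqP cop_ab) dvdn_gcd !(rank_dvd _ _ _ tr1, rank_dvd _ _ _ tr2).
(* Writing [rho e] as column times row makes [rho] of e t e the scalar R rho(t) C times [rho e];
   injectivity of [rho] then gives commutativity of eSe. *)
have [C [R defe]] : exists (C : 'cV[algC]_n) (R : 'rV[algC]_n), rho e = C *m R.
  move: (col_base (rho e)) (row_base (rho e)) (mulmx_base (rho e)).
  by rewrite rank1 => C R <-; exists C, R.
have [m [x [y [xyP yx sum_xy]]]] := matrix_units simpleS nze ee divE (mulr1 1).
case: m => [|m] in xyP yx sum_xy.
  by move: sum_xy; rewrite big_ord0 => /eqP; rewrite eq_sym oner_eq0.
exists m, (subvs_of (corner nze ee)); split.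
- exact: corner_division.
- move=> z w; apply: val_inj; apply: simple_falg_inj => /=; rewrite !rhoM.
  have rE (t : subvs_of (corner nze ee)) :
      exists k : algC, rho (vsval t) = k *: rho e.
    have := subvsP t; rewrite mem_corner // => /eqP <-; rewrite !rhoM defe.
    exists ((R *m rho (vsval t) *m C) 0 0).
    by rewrite scalemxAr -mul_scalar_mx -mx11_scalar !mulmxA.
  have [[k ->] [l ->]] := (rE z, rE w).
  by rewrite -!scalemxAl -!scalemxAr !scalerA mulrC.
apply: (@corner_ring_iso _ _ e nze ee m x y) => // i lt_i.
by case: (xyP i lt_i).
Qed.

End TraceArgument.

(** * Matrix algebras over commutative division algebras *)

Section MatrixOverField.

Variables (S D : falgType rat) (m : nat).
Hypotheses (divD : division_ring D) (comD : commutative (@GRing.mul D)).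
Hypothesis isoS : ring_iso S 'M[D]_m.+1.

Lemma comm_Schur_index : has_Schur_index S 1.
Proof.
exists m, D; split=> //; have -> : 'Z({:D})%VS = fullv.
  apply/vspaceP=> z; rewrite memv_cap !memvf /=.
  by apply/centvP=> w _; apply: comD.
by rewrite divnn adim_gt0.
Qed.

(** Two distinct diagonal matrix units multiply to 0, so a division ring allows only size 1. *)
Lemma division_matrix_comm : division_ring S -> commutative (@GRing.mul S).
Proof.
move=> divS; have [f [g fK gK]] := isoS; have injf := can_inj fK.
have m0 : m = 0%N.
  apply/eqP; apply: contraT => nzm; pose i1 : 'I_m.+1 := ord_max.
  have ne01 : (0 : 'I_m.+1) != i1 by rewrite -val_eqE /= eq_sym.
  have nz i : g (delta_mx i i) != 0.
    apply/eqP=> gi0; have /matrixP/(_ i i)/eqP : delta_mx i i = 0 :> 'M[D]_m.+1.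
      by rewrite -(gK (delta_mx i i)) gi0 rmorph0.
    by rewrite !mxE !eqxx oner_eq0.
  have : g (delta_mx 0 0) * g (delta_mx i1 i1) = 0.
    by apply: injf; rewrite rmorphM !gK rmorph0; apply: mul_delta_mx_0.
  move/(congr1 (fun z => (g (delta_mx 0 0))^-1 * z)).
  by rewrite mulKr ?divS ?nz // mulr0 => /eqP; rewrite (negPf (nz _)).
move=> u v; apply: injf; rewrite !rmorphM; move: (f u) (f v); rewrite m0 => A B.
rewrite -[_ * _]/(A *m B) -[_ * _]/(B *m A).
apply/matrixP=> i j; rewrite !mxE !big_ord1 !ord1 comD //.
Qed.

End MatrixOverField.

(** * Simple components and their complex representations *)

Section SimpleComponent.

Variables (gT : finGroupType) (G : {group gT}) (B : {aspace grpalg rat gT}).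
Hypothesis simB : simple_component G B.
Local Notation QG := (grpalg_of rat G).

Let sBQ : {subset B <= QG}.
Proof. by move=> u; case: simB => [[sBQ _ _] _]; apply: (subvP sBQ). Qed.

Let memBl u b : u \in QG -> b \in B -> u * b \in B.
Proof. by case: simB => [[_ /prodvP QB _] _] Qu Bb; apply: QB. Qed.

Let memBr u b : u \in QG -> b \in B -> b * u \in B.
Proof. by case: simB => [[_ _ /prodvP BQ] _] Qu Bb; apply: BQ. Qed.

Let algidC u : u \in QG -> algid B * u = u * algid B.
Proof.
move=> Qu; have Be := memv_algid B.
by rewrite -[LHS](algidr (memBr Qu Be)) -mulrA (algidl (memBl Qu Be)).
Qed.

(** Ideals of [B] are ideals of QG: with e the identity of [B], an element u of QG acts on [B] as u
    e or e u, which lie in [B]. *)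
Lemma simple_component_falg : simple_falg (subvs_of B).
Proof.
move=> I /prodvP SI /prodvP IS; pose J := (linfun (@vsval _ _ B) @: I)%VS.
have JP u : reflect (exists2 w, w \in I & u = vsval w) (u \in J).
  by apply: (iffP memv_imgP) => -[w Iw ->]; exists w; rewrite ?lfunE.
have sJB : (J <= B)%VS by apply/subvP=> _ /JP[w _ ->]; apply: subvsP.
have [_ minB] := simB; have idJ : two_sided_ideal QG J.
  split; first by apply/subvP=> u /(subvP sJB)/sBQ.
    apply/prodvP=> u _ Qu /JP[w Iw ->]; apply/JP.
    have Bue := memBl Qu (memv_algid B).
    exists (vsproj B (u * algid B) * w); first by rewrite SI ?memvf.
    by rewrite /= vsprojK // -mulrA algidl ?subvsP.
  apply/prodvP=> _ u /JP[w Iw ->] Qu; apply/JP.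
  have Beu := memBr Qu (memv_algid B).
  exists (w * vsproj B (algid B * u)); first by rewrite IS ?memvf.
  by rewrite /= vsprojK // mulrA algidr ?subvsP.
have [J0 | JB] := minB J idJ sJB.
  left; apply/eqP; rewrite -subv0; apply/subvP=> w Iw.
  have : vsval w \in J by apply/JP; exists w.
  by rewrite J0 !memv0 -[0]/(vsval (0 : subvs_of B)) (inj_eq val_inj).
right; apply/vspaceP=> w; rewrite memvf.
suffices /JP[w' Iw' /val_inj->] : vsval w \in J by [].
by rewrite JB subvsP.
Qed.

(** The identity e of [B] is a central idempotent, so every irreducible representation sends it to 0
    or 1, and by faithfulness some one to 1. There f and its projection e f have the same image. *)
Lemma simple_component_repr :
  exists (j : Iirr G)
    (rho : {additive subvs_of B -> 'M[algC]_(irr_degree (socle_of_Iirr j))}),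
    [/\ forall u v, rho (u * v) = rho u *m rho v, rho 1 = 1%:M
      & forall f, f \in QG -> f * f = f ->
          exists2 f', f' * f' = f' & rho f' = grpalg_mx 'Chi_j f].
Proof.
have Be := memv_algid B; have Qe := sBQ Be; set e := algid B in Be Qe.
have ee : e * e = e by apply: algidl.
have [j nz_ej] : exists j : Iirr G, grpalg_mx 'Chi_j e != 0.
  apply/existsP; apply: contraT; rewrite negb_exists => /forallP e0.
  case/eqP: (algid_neq0 B); apply: (grpalg_mx_eq0 Qe) => j.
  by apply/eqP; rewrite -[_ == 0]negbK e0.
have rho_e : grpalg_mx 'Chi_j e = 1%:M.
  have /is_scalar_mxP[a defa] : is_scalar_mx (grpalg_mx 'Chi_j e).
    apply: (mx_abs_irr_cent_scalar (groupC (socle_irr _))).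
    apply/centgmxP=> x Gx; rewrite -grpalg_mx_ga // -!grpalg_mxM ?ga_grpalg_of //.
    by rewrite algidC ?ga_grpalg_of.
  rewrite defa; congr (_%:M); move: nz_ej; rewrite defa => nz_a.
  have nza : a != 0 by apply: contraNneq nz_a => ->; rewrite raddf0.
  apply: (mulfI nza); rewrite mulr1.
  pose i0 := Ordinal (irr_degree_gt0 (socle_of_Iirr j)).
  have /matrixP/(_ i0 i0) : (a * a)%:M = a%:M :> 'M[algC]_(irr_degree (socle_of_Iirr j)).
    by rewrite scalar_mxM -defa -grpalg_mxM // ee.
  by rewrite !mxE eqxx.
exists j, (grpalg_mx 'Chi_j \o vsval); split=> [u v | | f Qf ff] /=.
- by rewrite grpalg_mxM // ?sBQ ?subvsP.
- exact: rho_e.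
have Bef := memBr Qf Be; exists (vsproj B (e * f)).
  apply: val_inj; rewrite /= vsprojK //.
  by rewrite mulrA -[e * f * e]mulrA -algidC // mulrA ee -mulrA ff.
by rewrite vsprojK // grpalg_mxM // rho_e mul1mx.
Qed.

End SimpleComponent.

(** * Two idempotents with coprime traces *)

Lemma trace_eQ_lin (gT : finGroupType) (G L : {group gT}) (j : Iirr G) (l : Iirr L) :
    L \subset G -> 'chi_l \is a linear_char ->
  \tr (grpalg_mx 'Chi_j (eQ l)) = \sum_(m | gal_conj l m) '['chi_j, 'Ind[G] 'chi_m].
Proof.
move=> sLG lin_l.
transitivity (\sum_(g in L) #|L|%:R^-1 * \sum_(m | gal_conj l m) 'chi_m g * 'chi_j g^-1%g).
  rewrite /eQ (raddf_sum (grpalg_mx 'Chi_j)) raddf_sum /=; apply: eq_bigr => g Lg.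
  rewrite grpalg_mxZ mxtraceZ eQ_coefK eQ_coefE lin_char1 // mul1r -mulrA; congr (_ * _).
  rewrite mulr_suml; apply: eq_bigr => m _; congr (_ * _).
  by rewrite grpalg_mx_ga ?groupV ?(subsetP sLG) // -irrRepr cfunE groupV (subsetP sLG).
rewrite -mulr_sumr exchange_big mulr_sumr; apply: eq_bigr => m _.
rewrite -cfdot_Res_l cfdotC_char ?cfRes_char ?irr_char // cfdotE; congr (_ * _).
by apply: eq_bigr => g Lg; rewrite cfResE // irr_inv.
Qed.

Lemma grpalg_avg_idem (gT : finGroupType) (H : {group gT}) :
  let f := #|H|%:R^-1 *: \sum_(h in H) ga rat h in f * f = f.
Proof.
move=> f; have gaf h : h \in H -> ga rat h * f = f.
  move=> Hh; rewrite -scalerAr mulr_sumr; congr (_ *: _).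
  rewrite [RHS](reindex_inj (mulgI h)) /=; apply: eq_big => [x|x _]; first by rewrite groupMl.
  exact: gaM.
rewrite {1}/f -scalerAl mulr_suml (eq_bigr _ gaf) sumr_const -scaler_nat scalerA.
by rewrite mulVf ?scale1r // pnatr_eq0 -lt0n cardG_gt0.
Qed.

Section FrobeniusIdempotents.

Variables (gT : finGroupType) (G K H : {group gT}).
Hypotheses (frobG : [Frobenius G = K ><| H]) (cycH : cyclic H) (oddG : odd #|G|).

Let defG : K ><| H = G. Proof. by have [] := Frobenius_context frobG. Qed.
Let nsKG : K <| G. Proof. by have [] := sdprod_context defG. Qed.
Let sHG : H \subset G. Proof. by have [] := sdprod_context defG. Qed.

(** The character induced from [K] vanishes outside [K], so only the identity of [H] contributes. *)
Let tr_avg (k : Iirr K) (j : Iirr G) : 'chi_j = 'Ind[G] 'chi_k ->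
  \tr (grpalg_mx 'Chi_j (#|H|%:R^-1 *: \sum_(h in H) ga rat h)) = 'chi_k 1%g.
Proof.
move=> def_j; rewrite grpalg_mxZ mxtraceZ (raddf_sum (grpalg_mx 'Chi_j)) raddf_sum /= fmorphV rmorph_nat.
rewrite (eq_bigr 'chi_j) => [|h Hh]; last first.
  by rewrite grpalg_mx_ga ?(subsetP sHG) // -irrRepr cfunE (subsetP sHG).
rewrite (bigD1 1%g) //= big1 ?addr0 => [|h /andP[Hh nth]].
  by rewrite def_j cfInd1 ?(normal_sub nsKG) // -(index_sdprod defG) mulKf ?neq0CG.
rewrite def_j (cfun_on0 (cfInd_normal _ nsKG)) //; apply: contra nth => Kh.
have [_ _ _ _ tiKH] := sdprod_context defG.
by rewrite -in_set1 -set1gE -tiKH inE Kh.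
Qed.

(** By Clifford, the characters counted are the [H]-conjugates of ['chi_k] that are also its Galois
    conjugates. The two actions commute, so [H0] is a subgroup, and it acts freely because the
    inertia group of a nontrivial character of [K] is [K]. *)
Let card_conj (k : Iirr K) (j : Iirr G) : k != 0 -> 'chi_j = 'Ind[G] 'chi_k ->
  (#|[set k' | gal_conj k k' & 'Ind[G] 'chi_k' == 'chi_j]| %| #|H|)%N.
Proof.
move=> ntk def_j; have nKH : H \subset 'N(K) by have [] := sdprod_context defG.
pose H0 := [set h in H | gal_conj k (conjg_Iirr k h)].
have gH0 : group_set H0.
  apply/group_setP; split=> [|x y /setIdP[Hx kx] /setIdP[Hy ky]].
    by rewrite inE group1 (_ : conjg_Iirr k 1 = k) ?gal_conj_refl //;
       apply: irr_inj; rewrite conjg_IirrE cfConjgJ1.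
  rewrite inE groupM //= (gal_conj_eq ky).
  rewrite (_ : conjg_Iirr k (x * y) = conjg_Iirr (conjg_Iirr k x) y); last first.
    by apply: irr_inj; rewrite !conjg_IirrE (cfConjgM _ nsKG) ?(subsetP sHG).
  by rewrite gal_conj_conjg // (subsetP nKH).
suffices <- : #|H0| = #|[set k' | gal_conj k k' & 'Ind[G] 'chi_k' == 'chi_j]|.
  have sH0H : group gH0 \subset H by apply/subsetP=> h /setIdP[].
  exact: cardSg sH0H.
have [_ _ _ _ tiKH] := sdprod_context defG.
have inj_conj : {in H0 &, injective (conjg_Iirr k)}.
  move=> x y /setIdP[Hx _] /setIdP[Hy _] /(congr1 (fun i => 'chi_i)) /eqP.
  rewrite !conjg_IirrE (cfConjg_eqE _ nsKG) ?(subsetP sHG) //.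
  rewrite (inertia_Frobenius_ker (FrobeniusWker frobG) ntk) mem_rcoset => Kyx.
  apply/eqP; rewrite eq_sym eq_mulgV1 -in_set1 -set1gE -tiKH inE Kyx.
  by rewrite groupM ?groupV.
rewrite -(card_in_imset inj_conj); apply: eq_card => k'; rewrite [RHS]inE.
apply/imsetP/andP=> [[h /setIdP[Hh kh] ->] | [kk' /eqP indk']].
  split=> //; rewrite def_j; apply/eqP/esym/cfclass_Ind => //.
  by apply/cfclassP; exists h; rewrite ?conjg_IirrE ?(subsetP sHG).
have /cfclassP[g Gg def_k'] : 'chi_k' \in ('chi_k ^: G)%CF.
  have Clif : k \in irr_constt ('Res[K] 'chi_j).
    by rewrite irr_consttE cfdot_Res_l -def_j cfnorm_irr oner_eq0.
  apply: contraT => notcl; suffices /eqP : 1 = 0 :> algC by rewrite oner_eq0.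
  rewrite -(cfnorm_irr j) -{2}indk' -cfdot_Res_l (Clifford_Res_sum_cfclass nsKG Clif).
  rewrite cfdotZl cfdot_suml big_seq big1 ?mulr0 // => _ /cfclassP[y Gy ->].
  rewrite -conjg_IirrE cfdot_irr (_ : (_ == _) = false) //.
  apply: contraNF notcl => /eqP <-; rewrite conjg_IirrE.
  by apply/cfclassP; exists y.
have /mulsgP[y h Ky Hh def_g] : g \in (K * H)%g by rewrite (sdprodW defG).
have def_k'h : k' = conjg_Iirr k h.
  apply: irr_inj; rewrite conjg_IirrE def_k' def_g.
  rewrite (cfConjgM _ nsKG) ?(cfConjg_id _ Ky) //; last exact: subsetP sHG h Hh.
  exact: subsetP (normal_sub nsKG) y Ky.
by exists h; rewrite // inE Hh -def_k'h.
Qed.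

Lemma Frobenius_cyclic_idempotents (j : Iirr G) :
  exists f1 f2 (a b : nat),
    [/\ [/\ f1 \in grpalg_of rat G, f1 * f1 = f1 & \tr (grpalg_mx 'Chi_j f1) = a%:R],
        [/\ f2 \in grpalg_of rat G, f2 * f2 = f2 & \tr (grpalg_mx 'Chi_j f2) = b%:R]
      & coprime a b].
Proof.
have [sKj | nsKj] := boolP (K \subset cfker 'chi_j).
  have lin_j := Frobenius_cyclic_lin frobG cycH sKj.
  (* ['chi_j] is linear here, so the idempotent 1 has trace 1 and serves twice. *)
  suffices H1 : [/\ 1 \in grpalg_of rat G, 1 * 1 = 1 :> grpalg rat gT
      & \tr (grpalg_mx 'Chi_j 1) = 1%:R] by exists 1, 1, 1%N, 1%N.
  split; rewrite ?mulr1 // -[1]/(ga rat 1%g) ?ga_grpalg_of //.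
  by rewrite grpalg_mx_ga // repr_mx1 mxtrace1 -irr1_degree lin_char1.
have [k [L [l [ntk def_j sLK lin_l [def_k nuE]]]]] :=
  Frobenius_cyclic_monomial frobG cycH oddG nsKj.
have sLG : L \subset G := subset_trans sLK (normal_sub nsKG).
exists (#|H|%:R^-1 *: \sum_(h in H) ga rat h), (eQ l), (irr_degree (socle_of_Iirr k)).
exists #|[set k' | gal_conj k k' & 'Ind[G] 'chi_k' == 'chi_j]|; split.
- split; [|exact: grpalg_avg_idem |by rewrite (tr_avg def_j) irr1_degree].
  by rewrite memvZ // rpred_sum // => h Hh; rewrite ga_grpalg_of ?(subsetP sHG).
- split; [|exact: eQ_idem | rewrite (trace_eQ_lin _ sLG lin_l)].
    apply/grpalg_ofP=> g notGg; apply: (grpalg_ofP _ _ (eQ_grpalg l)).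
    by apply: contra notGg; apply: subsetP.
  have def_jl : 'chi_j = 'Ind[G] 'chi_l by rewrite def_j def_k cfIndInd ?(normal_sub nsKG).
  have autI nu : cfAut nu 'chi_j = 'Ind[G] (cfAut nu 'chi_l) by rewrite def_jl cfAutInd.
  have irrI (nu : {rmorphism algC -> algC}) m : 'chi_m = cfAut nu 'chi_l -> 'chi_(Ind_Iirr K m) = cfAut nu 'chi_k.
    by move=> def_m; rewrite /Ind_Iirr def_m -cfAutInd -def_k -aut_IirrE irrK.
  pose A := [set m | gal_conj l m & 'Ind[G] 'chi_m == 'chi_j].
  (* If two Galois conjugates of lambda induce the same character of [K], the quotient of the two
     automorphisms fixes psi, hence lambda by [nuE]. *)
  have injA : {in A &, injective (Ind_Iirr K)}.
    move=> m1 m2 /setIdP[/gal_conjP[nu1 def1] _] /setIdP[/gal_conjP[nu2 def2] _].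
    move/(congr1 (fun i => 'chi_i)); rewrite (irrI _ _ def1) (irrI _ _ def2) => eq12.
    have fixk : cfAut (algC_invaut nu2 \o nu1) 'chi_k = 'chi_k.
      apply/cfunP=> x; move/cfunP/(_ x): eq12; rewrite !cfunE /= => ->.
      by rewrite algC_autK.
    apply: irr_inj; rewrite def1 def2; apply/cfunP=> x.
    have /cfunP/(_ x) := nuE _ fixk; rewrite !cfunE /= => fixl.
    by rewrite -[in RHS]fixl algC_invautK.
  suffices <- : #|A| = #|[set k' | gal_conj k k' & 'Ind[G] 'chi_k' == 'chi_j]|.
    rewrite -sum1_card natr_sum big_mkcond [RHS]big_mkcond; apply: eq_bigr => m _.
    rewrite inE; case: gal_conjP => //= -[nu def_m].
    by rewrite def_m -autI -aut_IirrE cfdot_irr eq_sym (inj_eq irr_inj); case: eqP.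
  rewrite -(card_in_imset injA); apply: eq_card => k'; rewrite [RHS]inE.
  apply/imsetP/andP=> [[m /setIdP[/gal_conjP[nu def_m] /eqP indm] ->] | ].
    split; first by apply/gal_conjP; exists nu; apply: irrI.
    by rewrite (irrI _ _ def_m) def_k cfAutInd -def_m cfIndInd ?(normal_sub nsKG) ?indm.
  case=> /gal_conjP[nu def_k'] /eqP indk'.
  have def_m : 'chi_(aut_Iirr nu l) = cfAut nu 'chi_l by rewrite aut_IirrE.
  exists (aut_Iirr nu l); last by apply: irr_inj; rewrite (irrI _ _ def_m).
  rewrite inE; apply/andP; split; first by apply/gal_conjP; exists nu.
  by rewrite def_m -indk' def_k' def_k cfAutInd cfIndInd ?(normal_sub nsKG).
have /coprime_dvdl -> // : (irr_degree (socle_of_Iirr k) %| #|K|)%N.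
  by have := dvd_irr1_cardG k; rewrite irr1_degree dvdC_nat.
rewrite coprime_sym; apply: coprime_dvdl (card_conj ntk def_j) _.
by rewrite coprime_sym (Frobenius_coprime frobG).
Qed.

End FrobeniusIdempotents.

(** * Schur indices and exceptional components *)

Lemma simple_component_Schur (gT : finGroupType) (G H K : {group gT})
    (B : {aspace grpalg rat gT}) :
    odd #|G| -> [Frobenius G = K ><| H] -> cyclic H -> simple_component G B ->
  has_Schur_index (subvs_of B) 1 /\ ~ exceptional (subvs_of B).
Proof.
move=> oddG frobG cycH simB.
have [j [rho [rhoM rho1 rho_idem']]] := simple_component_repr simB.
have simS := simple_component_falg simB.
have n_gt0 := irr_degree_gt0 (socle_of_Iirr j).
have [m [D [divD comD isoD]]] : exists m (D : falgType rat),
    [/\ division_ring D, commutative (@GRing.mul D) & ring_iso (subvs_of B) 'M[D]_m.+1].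
  have [f1 [f2 [a [b [[Qf1 ff1 tr1] [Qf2 ff2 tr2] cop_ab]]]]] :=
    Frobenius_cyclic_idempotents frobG cycH oddG j.
  have [f1' idf1 rf1] := rho_idem' f1 Qf1 ff1; have [f2' idf2 rf2] := rho_idem' f2 Qf2 ff2.
  by apply: (simple_falg_iso rhoM rho1 simS n_gt0 idf1 idf2 _ _ cop_ab); rewrite ?rf1 ?rf2.
split; first exact: comm_Schur_index divD comD isoD.
have odd_n : odd (irr_degree (socle_of_Iirr j)).
  by apply: dvdn_odd oddG; have := dvd_irr1_cardG j; rewrite irr1_degree dvdC_nat.
(* With [R] arbitrary this excludes types (ii), (iii) and (iv) together; type (i) falls to
   commutativity. *)
have noM2 (R : nzRingType) : ~ ring_iso (subvs_of B) 'M[R]_2.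
  by move/(matrix2_even rhoM rho1); rewrite odd_n.
case=> [[divB ncB _] | /noM2 | [F _ /noM2] | [a [b [_ _ /noM2]]]] //.
by apply: ncB; apply: division_matrix_comm comD isoD divB.
Qed.

Theorem theorem6p1 (gT : finGroupType) (G H : {group gT}) :
  odd #|G| -> [Frobenius G with complement H]%g -> cyclic H ->
  [/\ gen_strongly_monomial G,
      forall B : {aspace grpalg rat gT},
        simple_component G B -> has_Schur_index (subvs_of B) 1
    & forall B : {aspace grpalg rat gT},
        simple_component G B -> ~ exceptional (subvs_of B)].
Proof.
move=> oddG frobG cycH; have [K frobGK] := Frobenius_kernel_exists frobG.
split=> [|B simB|B simB]; first exact: Frobenius_cyclic_gsm frobGK cycH oddG.
  by have [] := simple_component_Schur oddG frobGK cycH simB.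
by have [] := simple_component_Schur oddG frobGK cycH simB.
Qed.
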